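(* Let $G$ be a periodic graph on $\mathbb{Z}^d\times S$ satisfying the standing assumptions in the context. For $u\in\mathcal{V}_S$, let $$g^u=\int_{T^d}\sum_{m=1}^k \mathrm{Re}\left\{c^u(\alpha,m)\,(1-\lambda(\alpha,m))^{-1}\,v(\alpha,m)\otimes\xi^\alpha\right\}d\alpha \qquad (1)$$ and for $1\le j\le d$ define $$g^{u,j}=\int_{T^d}\sum_{m=1}^k \mathrm{Re}\left\{c^u(\alpha,m)\,(1-\lambda(\alpha,m))^{-1}\,(1-e^{-2\pi i\alpha_j})\,v(\alpha,m)\otimes\xi^\alpha\right\}d\alpha . \qquad (2)$$ The integrals are meant pointwise, i.e. as defining $g^u(x)$ and $g^{u,j}(x)$ for each vertex $x$ of $G$. Then: (i) the integrand in (2) is always integrable, and the integrand in (1) is integrable when $d\ge 3$, or when $d=1$ or $2$ and $\sum_{l=1}^k u_l=0$; (ii) $(I-A)g^u=u\otimes\delta_0$ and $(I-A)g^{u,j}=u\otimes(\delta_0-\delta_{e_j})$ whenever the integrals exist, where $e_j$ is the $j$-th standard basis vector of $\mathbb{Z}^d$; (iii) $g^u$ and $g^{u,j}$ are bounded whenever the defining integrals exist.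
   Context: Let $d,k\ge1$ and $S=\{1,\dots,k\}$. $G$ is an undirected graph with vertex set $\mathbb{Z}^d\times S$, possibly with parallel edges and self-edges, which is periodic: its edges (with multiplicity) are invariant under the translations $(x,l)\mapsto(x+a,l)$, $a\in\mathbb{Z}^d$. Standing assumptions: $G$ is connected, $D$-regular (every vertex has exactly $D<\infty$ incident edges counted with multiplicity, a self-edge being counted once), and has at least one self-edge (so that simple random walk on $G$ is aperiodic). $\mathcal{V}_S,\mathcal{V}_{\mathbb{Z}^d},\mathcal{V}_G$ denote the spaces of complex-valued functions on $S$, $\mathbb{Z}^d$, $\mathbb{Z}^d\times S$ respectively. For $u\in\mathcal{V}_S$ and $g\in\mathcal{V}_{\mathbb{Z}^d}$, $u\otimes g\in\mathcal{V}_G$ is given by $(u\otimes g)(x,l)=g(x)u_l$. $\delta_y\in\mathcal{V}_{\mathbb{Z}^d}$ is the indicator of $y$. $I$ is the identity and $A$ is the operator on $\mathcal{V}_G$ with $(Af)(x,l)=D^{-1}\sum_{(y,j)\sim(x,l)}f(y,j)$, where $(y,j)$ is counted as many times as there are edges between $(x,l)$ and $(y,j)$. $T^d=\mathbb{R}^d/\mathbb{Z}^d$, with elements written as $d$-tuples of elements of $(-1/2,1/2]$, and $d\alpha$ is Haar probability measure on it. $\xi^\alpha\in\mathcal{V}_{\mathbb{Z}^d}$ is $\xi^\alpha(x)=e^{2\pi i\alpha\cdot x}$. For $x\in\mathbb{Z}^d$, $R^x$ is the $k\times k$ matrix with $R^x(l,j)$ the number of edges between $(0,l)$ and $(x,j)$,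 and $Q(\alpha)=D^{-1}\sum_{x\in\mathbb{Z}^d}e^{2\pi i\alpha\cdot x}R^x$, a Hermitian $k\times k$ matrix. $\{v(\alpha,m):1\le m\le k\}$ is a measurable (in $\alpha$) choice of ordered unitary (orthonormal) eigenbasis of $Q(\alpha)$, $\lambda(\alpha,m)$ is the (real) eigenvalue corresponding to $v(\alpha,m)$, and $c^u(\alpha,m)=\langle u,v(\alpha,m)\rangle$ are the coefficients of $u$ in this basis, i.e. $\sum_m c^u(\alpha,m)v(\alpha,m)=u$ for every $\alpha\in T^d$.
   Formalization: u is assumed to have real entries in (ii), and in (i) when d=1: because of the Re, g^u and g^{u,j} are real-valued, so (ii) fails for every non-real u, and (i) fails e.g. for d=k=1, u=i. Part (i) for d≥2 and (iii) are for all complex u. *)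

(* Defs.v *)
From HB Require Import structures.
From mathcomp Require Import all_boot all_order all_algebra.
From mathcomp Require Import all_classical all_reals all_analysis.
From mathcomp Require Export complex.

Set Implicit Arguments.
Unset Strict Implicit.
Unset Printing Implicit Defensive.

Import Order.TTheory GRing.Theory Num.Theory.
Import numFieldNormedType.Exports.

Local Open Scope classical_set_scope.
Local Open Scope complex_scope.
Local Open Scope ring_scope.

Notation vertex d k := ('rV[int]_d * 'I_k)%type.

Definition shift d k (a : 'rV[int]_d) (p : vertex d k) : vertex d k :=
  (p.1 + a, p.2).

(* A multigraph is given by its edge multiplicities; [G p p] is the number of
   self-edges at [p], so that each self-edge counts once in the degree. *)
Record periodic_graph (d k : nat) := PeriodicGraph {
  mult :> vertex d k -> vertex d k -> nat;
  mult_sym : forall p q, mult p q = mult q p;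
  mult_shift : forall a p q, mult (shift a p) (shift a q) = mult p q
}.

Section Graph.
Variables d k : nat.
Implicit Type G : periodic_graph d k.

Definition connected_graph G : Prop :=
  forall p q : vertex d k,
    exists2 s : seq (vertex d k), path (fun a b => (0 < G a b)%N) p s
                                  & last p s = q.

(* Sums [\sum_(q \in A) F q] are 0 by convention when [F] has infinite support
   in [A], whence the explicit finiteness requirement. *)
Definition regular_graph G (D : nat) : Prop :=
  forall p : vertex d k,
    finite_set [set q | G p q <> 0%N] /\
    (\big[addn/0]_(q \in [set: vertex d k]) G p q)%N = D.

Definition has_self_edge G : Prop := exists p : vertex d k, (0 < G p p)%N.

End Graph.

(* [T^d] is represented by the cube (-1/2, 1/2]^d, and its Haar probability
   measure by the d-fold product of the uniform probability on [-1/2, 1/2],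
   for which the cube has measure 1. *)
Section Torus.
Variable R : realType.

Definition torus d : set (d.-tuple R) :=
  [set a | forall i : 'I_d, - 2^-1 < tnth a i <= 2^-1].

Fact half_itv : - 2^-1 < 2^-1 :> R.
Proof. by rewrite gtrN// invr_gt0. Qed.

Definition cons_pair d (p : measurableTypeR R * d.-tuple R) : d.+1.-tuple R :=
  [the d.+1.-tuple R of p.1 :: p.2].

Fact measurable_cons_pair d :
  measurable_fun [set: measurableTypeR R * d.-tuple R] (@cons_pair d).
Proof. by apply: measurable_cons. Qed.

HB.instance Definition _ d :=
  isMeasurableFun.Build _ _ _ _ (@cons_pair d) (@measurable_cons_pair d).

Fixpoint haar d : probability (d.-tuple R) R :=
  match d with
  | 0 => dirac ([tuple] : 0.-tuple R)
  | d'.+1 => distribution (uniform_prob half_itv \x haar d')%E (@cons_pair d')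
  end.

End Torus.

(* V_S is ['cV[R[i]]_k], V_{Z^d} is ['rV[int]_d -> R[i]] and V_G is
   [vertex d k -> R[i]]. *)
Section Spaces.
Variables (R : realType) (d k : nat).
Local Notation C := R[i].

Definition tensor (u : 'cV[C]_k) (g : 'rV[int]_d -> C) : vertex d k -> C :=
  fun p => g p.1 * u p.2 0.

Definition delta (y : 'rV[int]_d) : 'rV[int]_d -> C := fun x => (x == y)%:R.

Definition unit_vec (j : 'I_d) : 'rV[int]_d := delta_mx 0 j.

(* [g_fun] and [gj_fun] below are real-valued, so that [(I - A) g^u] can only be
   [u \otimes delta_0] for [u] with real entries. *)
Definition real_vec (u : 'cV[C]_k) : Prop := forall l, complex.Im (u l 0) = 0.

Definition inner (u v : 'cV[C]_k) : C := \sum_(l < k) u l 0 * conjc (v l 0).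

Definition walk_op (G : periodic_graph d k) (D : nat) (f : vertex d k -> C) :
    vertex d k -> C :=
  fun p => D%:R^-1 * \sum_(q \in [set: vertex d k]) (G p q)%:R * f q.

Definition I_minus_A (G : periodic_graph d k) (D : nat) (f : vertex d k -> C) :
    vertex d k -> C :=
  fun p => f p - walk_op G D f p.

Definition bounded_vfun (f : vertex d k -> C) : Prop :=
  exists M : R, forall p, `|f p| <= M%:C.

Definition expi2pi (t : R) : C := cos (2 * pi * t) +i* sin (2 * pi * t).

Definition dot (a : d.-tuple R) (x : 'rV[int]_d) : R :=
  \sum_(i < d) tnth a i * (x 0 i)%:~R.

Definition xi (a : d.-tuple R) : 'rV[int]_d -> C := fun x => expi2pi (dot a x).

Definition Rmat (G : periodic_graph d k) (x : 'rV[int]_d) : 'M[C]_k :=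
  \matrix_(l < k, j < k) (G (0, l) (x, j))%:R.

Definition Q (G : periodic_graph d k) (D : nat) (a : d.-tuple R) : 'M[C]_k :=
  D%:R^-1 *: \sum_(x \in [set: 'rV[int]_d]) xi a x *: Rmat G x.

Definition measurable_eigenbasis (G : periodic_graph d k) (D : nat)
    (v : d.-tuple R -> 'I_k -> 'cV[C]_k) (lam : d.-tuple R -> 'I_k -> R) : Prop :=
  [/\ forall m l,
        measurable_fun (@torus R d) (fun a => complex.Re (v a m l 0)) /\
        measurable_fun (@torus R d) (fun a => complex.Im (v a m l 0)),
      forall a, @torus R d a ->
        forall m n, inner (v a m) (v a n) = (m == n)%:R
    & forall a, @torus R d a ->
        forall m, Q G D a *m v a m = (lam a m)%:C *: v a m].

End Spaces.

Section Green.
Variables (R : realType) (d k : nat).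
Local Notation C := R[i].
Variables (v : d.-tuple R -> 'I_k -> 'cV[C]_k) (lam : d.-tuple R -> 'I_k -> R).
Variable u : 'cV[C]_k.

Definition coef (a : d.-tuple R) (m : 'I_k) : C := inner u (v a m).

(* Since [0^-1 = 0], an eigenvalue equal to 1 (only possible at the point 0 of
   the torus when the graph is connected) contributes 0 to the integrands. *)
Definition g_integrand (p : vertex d k) (a : d.-tuple R) : R :=
  \sum_(m < k)
    complex.Re (coef a m * (1 - (lam a m)%:C)^-1 * tensor (v a m) (xi a) p).

Definition gj_integrand (j : 'I_d) (p : vertex d k) (a : d.-tuple R) : R :=
  \sum_(m < k)
    complex.Re (coef a m * (1 - (lam a m)%:C)^-1 * (1 - expi2pi (- tnth a j))
        * tensor (v a m) (xi a) p).

Definition torus_integrable (F : d.-tuple R -> R) : Prop :=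
  (haar R d).-integrable (@torus R d) (EFin \o F).

Definition g_fun : vertex d k -> C :=
  fun p => (\int[haar R d]_(a in @torus R d) g_integrand p a)%:C.

Definition gj_fun (j : 'I_d) : vertex d k -> C :=
  fun p => (\int[haar R d]_(a in @torus R d) gj_integrand j p a)%:C.

Definition g_exists : Prop := forall p, torus_integrable (g_integrand p).

Definition gj_exists (j : 'I_d) : Prop :=
  forall p, torus_integrable (gj_integrand j p).

End Green.

(* Main.v *)
(* Set [E(a,f) = sum G((0,l),(x,j)) |f_l - xi^a(x) f_j|^2 = 2 D Re <(I - Q(a)) f, f>].
   Connectedness bounds the oscillation of [xi^a (x) f] along paths by [E], so
   every eigenvalue satisfies [1 - lam >= c |a|^2]; two eigenvalues cannot both be
   close to 1, since some combination of their eigenvectors has zero sum. Hence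
   [det (I - Q(a)) >= c |a|^2] on the torus. By Cramer's rule the integrands are,
   off [a = 0], real parts of [P(a) / det (I - Q(a))], where [P] is a trigonometric
   polynomial with coefficients linear in [u]. For real [u] the real part of [P]
   is even, so that [P(0) = 0] leaves no singularity in it, and the imaginary part
   is [O(|a|)]; (i) follows from the integrability of [|a|^(-e)] for [e < d].
   For (ii), [(I - Q) adj (I - Q) = det] leaves the integral of a character.
   For (iii), the symmetry [a -> - a] discards the part of [u] that is imaginary;
   then [Re P / det] is integrable by hypothesis and [Im P / det = O(1/|a|)] is
   integrable for [d >= 2], while for [d = 1] it is a multiple of
   [sin / (1 - cos)] up to a bounded function, and the integrals of
   [sin y sin (n y) / (1 - cos y)] are bounded in [n]. *)
From HB Require Import structures.
Require Import Defs.
From mathcomp Require Import all_boot all_order all_algebra.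
From mathcomp Require Import all_classical all_reals all_analysis.
From mathcomp Require Import measurable_realfun ring lra.

Set Implicit Arguments.
Unset Strict Implicit.
Unset Printing Implicit Defensive.

Import Order.TTheory GRing.Theory Num.Theory.
Import numFieldNormedType.Exports.

Local Open Scope classical_set_scope.
Local Open Scope complex_scope.
Local Open Scope ring_scope.

(** * Haar measure on the torus *)

Section Haar.
Variable R : realType.

(** The eigenvectors are only a measurable choice and may jump, so nothing can be expanded in them
    near the origin. The quotient of Cramer's rule does not depend on that choice: edge
    multiplicities are real, so the adjugate and the determinant lie in a ring of trigonometric
    polynomials with real coefficients, where every estimate is explicit and [a -> - a] acts as
    conjugation. A complex [u] is split into two real vectors in order to stay in that ring. Under
    the real part its imaginary half contributes an odd function over the determinant, with a pole
    of order 1 that is in general not integrable when [d = 1]; this is why (i) asks for a real [u]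
    there. The obstacle in (iii) is uniformity in the vertex. For a fixed [x] the factor
    [Im (xi a x)] removes the pole of order 1, but with a constant that grows with [x]. Discarding
    that factor is affordable only where 1/|a| is integrable; in dimension 1 the bound has to come
    from cancellation instead of absolute values. *)

Lemma uniform_prob_le (A : set (measurableTypeR R)) : measurable A ->
  (uniform_prob (@half_itv R) A <= lebesgue_measure A)%E.
Proof.
move=> mA; rewrite /uniform_prob -[leRHS]mul1e -integral_cst//.
apply: ge0_le_integral => //.
- by move=> x _; rewrite lee_fin uniform_pdf_ge0 ?half_itv.
- apply/measurable_EFinP; apply: measurable_funTS; exact: measurable_uniform_pdf.
- move=> x _; rewrite lee_fin /uniform_pdf; case: ifP => // _.
  by rewrite (_ : 2^-1 - - 2^-1 = 1) ?invr1//; lra.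
Qed.

Lemma integral_uniformE (f : measurableTypeR R -> \bar R) :
  measurable_fun setT f -> (forall x, 0 <= f x)%E ->
  (\int[uniform_prob (@half_itv R)]_x f x =
   \int[lebesgue_measure]_(x in `[(- 2^-1)%R, 2^-1%R]) f x)%E.
Proof.
move=> mf f0; rewrite integral_uniform//.
by rewrite (_ : (2^-1 - - 2^-1)%R = 1%R) ?invr1 ?mul1e//; lra.
Qed.

Lemma integral_uniformN (f : measurableTypeR R -> \bar R) :
  measurable_fun setT f -> (forall x, 0 <= f x)%E ->
  (\int[uniform_prob (@half_itv R)]_x f (- x)%R =
   \int[uniform_prob (@half_itv R)]_x f x)%E.
Proof.
move=> mf f0; have mN : measurable_fun setT (-%R : measurableTypeR R -> measurableTypeR R).
  exact: oppr_measurable.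
rewrite !integral_uniformE//; last exact: measurableT_comp.
transitivity (\int[pushforward (@lebesgue_measure R) (-%R : measurableTypeR R -> measurableTypeR R)]_(x in `[(- 2^-1)%R, 2^-1%R]) f x)%E.
  rewrite ge0_integral_pushforward//; last exact: measurable_funTS.
  congr (integral _ _ _); apply/seteqP; split=> x /=; rewrite !in_itv/= => /andP[? ?];
    apply/andP; split; lra.
by apply: eq_measure_integral => A mA _; exact: lebesgue_measureN.
Qed.

Lemma measurable_torus d : measurable (@torus R d).
Proof.
rewrite (_ : @torus R d = \bigcap_(i in [set: 'I_d])
   ((fun a => tnth a i) @^-1` [set` `](- 2^-1 : R), 2^-1]])); last first.
  apply/seteqP; split=> a /=.
  - by move=> h i _ /=; rewrite in_itv/=; exact: h.
  - by move=> h i; have /= := h i I; rewrite in_itv.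
apply: fin_bigcap_measurable; first exact: finite_finset.
move=> i _; rewrite -[X in measurable X]setTI; exact: measurable_tnth.
Qed.

Definition cube d (r : R) : set (d.-tuple R) :=
  [set a | forall i : 'I_d, `|tnth a i| <= r].

Lemma measurable_cube d r : measurable (@cube d r).
Proof.
rewrite (_ : @cube d r = \bigcap_(i in [set: 'I_d])
   ((fun a => tnth a i) @^-1` [set` `[- r, r]])); last first.
  apply/seteqP; split=> a /=.
  - by move=> h i _ /=; rewrite in_itv/= -ler_norml; exact: h.
  - by move=> h i; have /= := h i I; rewrite in_itv/= -ler_norml.
apply: fin_bigcap_measurable; first exact: finite_finset.
move=> i _; rewrite -[X in measurable X]setTI; exact: measurable_tnth.
Qed.

Lemma haarS d (A : set (d.+1.-tuple R)) :
  haar R d.+1 A = (uniform_prob (@half_itv R) \x haar R d)%E (@cons_pair R d @^-1` A).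
Proof. by []. Qed.

(** Each coordinate is compared with Lebesgue measure, whose density dominates the uniform one.
    Since only an upper bound is claimed, radii beyond 1/2 are allowed. *)
Lemma haar_cube d r : 0 <= r -> (haar R d (@cube d r) <= ((2 * r) ^+ d)%:E)%E.
Proof.
move=> r0; elim: d => [|d IH].
  by rewrite expr0; apply: probability_le1; exact: measurable_cube.
rewrite haarS (_ : _ @^-1` _ = [set` `[- r, r]] `*` @cube d r); last first.
  apply/seteqP; split=> -[t b] /=.
  - move=> h; split; last first.
      by move=> i; have := h (lift ord0 i); rewrite tnthS.
    by have := h ord0; rewrite in_itv/= -ler_norml /tnth/=.
  - rewrite in_itv/= -ler_norml => -[h1 h2] i.
    by case: (unliftP ord0 i) => [j ->|->]; rewrite ?tnthS// /tnth.
rewrite product_measure1E//; last exact: measurable_cube.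
rewrite exprS EFinM; apply: lee_pmul => //.
apply: le_trans (uniform_prob_le _) _ => //=.
rewrite lebesgue_measure_itv/= lte_fin; case: ifP => _; last by rewrite lee_fin; lra.
by rewrite -EFinD lee_fin; lra.
Qed.

Lemma uniform_prob_half_open :
  uniform_prob (@half_itv R) [set` `]- 2^-1, 2^-1]] = 1%E.
Proof.
rewrite /uniform_prob integral_itv_obnd_cbnd; last first.
  apply/measurable_EFinP; apply: measurable_funTS; exact: measurable_uniform_pdf.
by rewrite integral_uniform_pdf1//; exact: half_itv.
Qed.

Lemma haar_torus d : haar R d (@torus R d) = 1%E.
Proof.
elim: d => [|d IH].
  by rewrite /= diracE mem_set// => -[].
rewrite haarS (_ : _ @^-1` _ = [set` `]- 2^-1, 2^-1]] `*` @torus R d); last first.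
  apply/seteqP; split=> -[t b] /=.
  - move=> h; split; last first.
      by move=> i; have := h (lift ord0 i); rewrite tnthS.
    by have := h ord0; rewrite in_itv/=  /tnth/=.
  - rewrite in_itv/= => -[h1 h2] i.
    by case: (unliftP ord0 i) => [j ->|->]; rewrite ?tnthS// /tnth.
rewrite product_measure1E//; last exact: measurable_torus.
rewrite [X in (_ * X)%E](_ : _ = 1%E); last exact: IH.
by rewrite mule1; exact: uniform_prob_half_open.
Qed.

Lemma haar_torusC d : haar R d (~` @torus R d) = 0%E.
Proof.
rewrite probability_setC; last exact: measurable_torus.
by rewrite haar_torus subee.
Qed.

Definition origin d : d.-tuple R := [tuple of nseq d 0].

Lemma tnth_origin d i : tnth (origin d) i = 0.
Proof. by rewrite (tnth_nth 0)/= nth_nseq; case: ifP. Qed.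

Lemma cube0 d : @cube d 0 = [set origin d].
Proof.
apply/seteqP; split => a /=.
  move=> h; apply: eq_from_tnth => i; rewrite tnth_origin.
  by apply/eqP; rewrite -normr_le0.
by move=> -> i; rewrite tnth_origin normr0.
Qed.

Lemma haar_origin d : (0 < d)%N -> haar R d [set origin d] = 0%E.
Proof.
move=> d0; apply/eqP; rewrite -measure_le0 -cube0.
apply: le_trans (haar_cube _ _) _ => //.
by rewrite mulr0 expr0n; case: d d0.
Qed.

Lemma measurable_origin d : measurable [set origin d].
Proof. rewrite -cube0; exact: measurable_cube. Qed.

Definition opp_tuple d (a : d.-tuple R) : d.-tuple R := [tuple - tnth a i | i < d].

Lemma tnth_opp d (a : d.-tuple R) i : tnth (opp_tuple a) i = - tnth a i.
Proof. by rewrite tnth_mktuple. Qed.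

Lemma measurable_opp_tuple d : measurable_fun setT (@opp_tuple d).
Proof.
apply/measurable_fun_tnthP => i.
rewrite (_ : _ \o _ = (-%R \o (fun a : d.-tuple R => tnth a i))); last first.
  by apply/funext => a /=; rewrite tnth_opp.
apply: measurableT_comp; [exact: oppr_measurable|exact: measurable_tnth].
Qed.

(** Induction on [d] by Tonelli, one coordinate at a time. The integral runs over the whole space
    because the half-open cube [torus] is not symmetric. *)
Lemma ge0_integral_haarN d (f : d.-tuple R -> \bar R) :
  measurable_fun setT f -> (forall x, 0 <= f x)%E ->
  (\int[haar R d]_a f (opp_tuple a) = \int[haar R d]_a f a)%E.
Proof.
elim: d f => [|d IH] f mf f0.
  by apply: eq_integral => a _; congr f; apply: eq_from_tnth => -[].
have mfo : measurable_fun setT (f \o @opp_tuple d.+1).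
  apply: measurableT_comp => //; exact: measurable_opp_tuple.
have oppc t b : opp_tuple (cons_pair (t, b)) = cons_pair (- t, opp_tuple b).
  apply: eq_from_tnth => i; rewrite tnth_opp.
  by case: (unliftP ord0 i) => [j ->|->]; rewrite ?tnthS ?tnth_opp// /tnth/=.
rewrite /= !ge0_integral_distribution//.
rewrite !fubini_tonelli1//=; try by apply: measurableT_comp.
transitivity (\int[uniform_prob (@half_itv R)]_t
    \int[haar R d]_b f (cons_pair ((- t)%R, b)))%E.
  apply: eq_integral => t _; rewrite /fubini_F/=.
  under eq_integral => b _ do rewrite oppc.
  rewrite (IH (fun b => f (cons_pair (- t, b))))//.
  apply: measurableT_comp => //; apply: measurableT_comp.
    exact: measurable_cons_pair.
  by apply: measurable_fun_pair => //; exact: measurable_cst.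
apply: (integral_uniformN (f := fun t => \int[haar R d]_b f (cons_pair (t, b)))%E).
  apply: (@measurable_fun_fubini_tonelli_F _ _ _ _ _ (haar R d) (f \o @cons_pair R d)) => //.
  exact: measurableT_comp.
  by move=> x; exact: f0.
by move=> t; apply: integral_ge0 => b _; exact: f0.
Qed.

Lemma integrable_haarN d (f : d.-tuple R -> R) :
  (haar R d).-integrable setT (EFin \o f) ->
  (haar R d).-integrable setT (EFin \o (f \o @opp_tuple d)).
Proof.
move=> /integrableP[mf fi].
have mo := @measurable_opp_tuple d.
apply/integrableP; split.
  by rewrite compA; exact: measurableT_comp.
rewrite (ge0_integral_haarN (f := fun a => `|(EFin \o f) a|%E))//.
exact: measurableT_comp.
Qed.

(** Positive and negative parts are invariant separately, so the equality holds even when one of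
    them has infinite integral. *)
Lemma Rintegral_haarN d (f : d.-tuple R -> R) :
  measurable_fun setT f ->
  \int[haar R d]_a f (opp_tuple a) = \int[haar R d]_a f a.
Proof.
move=> mf; rewrite /Rintegral; congr fine.
rewrite integralE [RHS]integralE; congr (_ - _)%E.
- rewrite -[RHS]ge0_integral_haarN//; last first.
    by apply: measurable_funepos; exact/measurable_EFinP.
  by apply: eq_integral => a _; rewrite !funeposE.
- rewrite -[RHS]ge0_integral_haarN//; last first.
    by apply: measurable_funeneg; exact/measurable_EFinP.
  by apply: eq_integral => a _; rewrite !funenegE.
Qed.

End Haar.

(** * Integrability of poles at the origin *)

Section Poles.
Variable R : realType.

(** The null set to be avoided: outside the cube nothing is known about the eigenvectors, and at the
    origin the determinant of [I - Q] vanishes. *)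
Definition off_torus d : set (d.-tuple R) := ~` @torus R d `|` [set origin R d].

Lemma measurable_off_torus d : measurable (@off_torus d).
Proof.
by apply: measurableU; [apply: measurableC; exact: measurable_torus|exact: measurable_origin].
Qed.

Lemma haar_off_torus d : (0 < d)%N -> haar R d (@off_torus d) = 0%E.
Proof.
move=> d0; rewrite measureU0; first exact: haar_torusC.
- by apply: measurableC; exact: measurable_torus.
- exact: measurable_origin.
- exact: haar_origin.
Qed.

Lemma ae_torus d (P : d.-tuple R -> Prop) : (0 < d)%N ->
  (forall a, @torus R d a -> a <> origin R d -> P a) -> {ae haar R d, forall a, P a}.
Proof.
move=> d0 h; exists (@off_torus d); split.
- exact: measurable_off_torus.
- exact: haar_off_torus.
- move=> a /= nP; apply: contrapT => /not_orP[/contrapT ta a0]; apply: nP; exact: h.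
Qed.

Lemma torus_minus_origin d :
  @torus R d `\` [set origin R d] = setT `\` @off_torus d.
Proof.
apply/seteqP; split => a /=.
- by move=> [ta a0]; split=> // -[].
- move=> [_ /not_orP[/contrapT ta a0]]; by split.
Qed.

(** Every function is measurable on a singleton, so the default value of the integrand at the pole
    does no harm. *)
Lemma measurable_off_origin d (h h' : d.-tuple R -> R) :
  (forall a, @torus R d a -> a <> origin R d -> h a = h' a) ->
  measurable_fun setT h' -> measurable_fun (@torus R d) h.
Proof.
move=> hh' mh'.
have mo := @measurable_origin R d; have mt := @measurable_torus R d.
have sub : @torus R d `&` [set origin R d] `<=` @torus R d by move=> a [].
rewrite -(setDUK sub).
apply/measurable_funU; [exact: measurableI|by apply: measurableD => //; exact: measurableI|].
split.
  apply: (@measurable_funS _ _ _ _ [set origin R d]) => //.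
  exact: measurable_fun_set1.
apply: (eq_measurable_fun h').
  by move=> a; rewrite inE => -[ta na]; rewrite hh'// => ao; apply: na.
exact: measurable_funTS.
Qed.

Lemma torus_integrableP d (h h' : d.-tuple R -> R) : (0 < d)%N ->
  (forall a, @torus R d a -> a <> origin R d -> h a = h' a) ->
  measurable_fun setT h' ->
  torus_integrable h <-> (haar R d).-integrable setT (EFin \o h').
Proof.
move=> d0 hh' mh'; have mh := measurable_off_origin hh' mh'.
rewrite /torus_integrable.
rewrite (negligible_integrable (N := [set origin R d]))//; last 4 first.
- exact: measurable_origin.
- exact: measurable_torus.
- exact/measurable_EFinP.
- exact: haar_origin.
rewrite (negligible_integrable (D := setT) (N := @off_torus d))//; last 3 first.
- exact: measurable_off_torus.
- exact/measurable_EFinP.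
- exact: haar_off_torus.
have mD : measurable (@torus R d `\` [set origin R d]).
  apply: measurableD; [exact: measurable_torus|exact: measurable_origin].
rewrite -torus_minus_origin; split; apply: eq_integrable => //;
  by move=> a; rewrite inE => -[ta /= na]; rewrite hh'.
Qed.

Lemma torus_integralE d (h h' : d.-tuple R -> R) : (0 < d)%N ->
  (forall a, @torus R d a -> a <> origin R d -> h a = h' a) ->
  measurable_fun setT h' -> torus_integrable h ->
  \int[haar R d]_(a in @torus R d) h a = \int[haar R d]_a h' a.
Proof.
move=> d0 hh' mh' ih; have /torus_integrableP := ih => /(_ h' d0 hh' mh') ih'.
rewrite /Rintegral; congr fine.
rewrite (negligible_integral (N := [set origin R d]))//; last 3 first.
- exact: measurable_origin.
- exact: measurable_torus.
- exact: haar_origin.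
rewrite [RHS](negligible_integral (N := @off_torus d))//; last 2 first.
- exact: measurable_off_torus.
- exact: haar_off_torus.
rewrite -torus_minus_origin; apply: eq_integral.
by move=> a; rewrite inE => -[ta /= na]; rewrite hh'.
Qed.

Lemma ae_Rintegral d (f g : d.-tuple R -> R) : (0 < d)%N ->
  measurable_fun setT f -> measurable_fun setT g ->
  (forall a, @torus R d a -> a <> origin R d -> f a = g a) ->
  \int[haar R d]_a f a = \int[haar R d]_a g a.
Proof.
move=> d0 mf mg fg; rewrite /Rintegral; congr fine; apply: ae_eq_integral => //.
- exact/measurable_EFinP.
- exact/measurable_EFinP.
- by apply: ae_torus => // a ta a0 _ /=; rewrite fg.
Qed.

Definition supn d (a : d.-tuple R) : R := \big[Num.max/0]_(i < d) `|tnth a i|.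

Lemma supn_ge0 d (a : d.-tuple R) : 0 <= supn a.
Proof. by rewrite /supn; elim/big_ind: _ => // x y x0 y0; rewrite le_max x0. Qed.

Lemma tnth_le_supn d (a : d.-tuple R) i : `|tnth a i| <= supn a.
Proof. by rewrite /supn (bigD1 i)//= le_max lexx. Qed.

Lemma supn_le d (a : d.-tuple R) r : 0 <= r -> (supn a <= r) <-> @cube R d r a.
Proof.
move=> r0; split=> [h i|h]; first exact: le_trans (tnth_le_supn a i) h.
by rewrite /supn; elim/big_ind: _ => // x y x0 y0; rewrite ge_max x0.
Qed.

Lemma supn_gt0 d (a : d.-tuple R) : a <> origin R d -> 0 < supn a.
Proof.
move=> a0; rewrite lt_neqAle supn_ge0 andbT eq_sym; apply/eqP => s0; apply: a0.
have : @cube R d 0 a by apply/supn_le; rewrite // s0.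
by rewrite cube0.
Qed.

Lemma supn_torus d (a : d.-tuple R) : @torus R d a -> supn a <= 2^-1.
Proof.
move=> ta; apply/supn_le => // i; have /andP[h1 h2] := ta i.
by rewrite ler_norml h2 ltW.
Qed.

Lemma dyadic_scale (s : R) : 0 < s -> s <= 1 -> exists n, 2^-1 ^+ n.+1 < s <= 2^-1 ^+ n.
Proof.
move=> s0 s1.
have ex : exists n, 2^-1 ^+ n < s.
  exists (Num.bound s^-1); rewrite exprVn invf_plt ?posrE ?exprn_gt0//.
  have /archi_boundP : 0 <= s^-1 by rewrite invr_ge0 ltW.
  move/lt_le_trans; apply; rewrite -natrX ler_nat ltnW//; exact: ltn_expl.
case: (ex_minnP ex) => -[|n] h1 h2; first by move: h1; rewrite expr0 ltNge s1.
exists n; rewrite h1 /= leNgt; apply/negP => /h2; by rewrite ltnn.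
Qed.

(* Dyadic decomposition around the pole: the cube of radius [2^-n] has measure
   [O(2^(-n d))], while [|h|] is [O(2^(n e))] off the next smaller cube. *)
Lemma integrable_pole d e (C : R) (h : d.-tuple R -> R) : (e < d)%N ->
  measurable_fun setT h ->
  (forall a, @torus R d a -> a <> origin R d -> `|h a| * supn a ^+ e <= C) ->
  (haar R d).-integrable setT (EFin \o h).
Proof.
move=> ed mh hC; have d0 : (0 < d)%N by apply: leq_trans ed.
pose C' := Num.max C 0 * 2 ^+ e.
have C'0 : 0 <= C' by rewrite mulr_ge0 ?exprn_ge0// le_max lexx orbT.
pose g (n : nat) (a : d.-tuple R) : \bar R :=
  (C' * 2 ^+ (n * e) * \1_(@cube R d (2^-1 ^+ n)) a)%:E.
have mg n : measurable_fun setT (g n).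
  apply/measurable_EFinP; apply: measurable_funM => //.
  apply: measurable_indic; exact: measurable_cube.
have g0 n a : (0 <= g n a)%E by rewrite lee_fin mulr_ge0 ?indicE// mulr_ge0// exprn_ge0.
apply/integrableP; split; first exact/measurable_EFinP.
apply: (@le_lt_trans _ _ (\int[haar R d]_a \sum_(n <oo) g n a)%E).
  apply: ae_ge0_le_integral => //.
  - by apply: measurableT_comp => //; exact/measurable_EFinP.
  - by move=> a _; apply: nneseries_ge0.
  - by apply: ge0_emeasurable_sum.
  apply: ae_torus => // a ta a0 _ /=.
  have s0 := supn_gt0 a0; have s1 : supn a <= 1 by apply: le_trans (supn_torus ta) _; lra.
  have [n /andP[n1 n2]] := dyadic_scale s0 s1.
  apply: (@le_trans _ _ (g n a)); last first.
    rewrite (nneseriesD1 (n := n))//; apply: leeDl; exact: nneseries_ge0.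
  rewrite /g lee_fin indicE mem_set ?mulr1; last first.
    by apply/supn_le => //; rewrite exprn_ge0.
  have se : 0 < supn a ^+ e by rewrite exprn_gt0.
  rewrite -(ler_pM2r se); apply: le_trans (hC a ta a0) _.
  apply: (@le_trans _ _ (Num.max C 0)); first by rewrite le_max lexx.
  rewrite /C' -!mulrA ler_peMr ?le_max ?lexx ?orbT// exprM -!exprMn.
  apply: exprn_ege1.
  rewrite -[leLHS](_ : 2 * (2 ^+ n * 2^-1 ^+ n.+1) = 1); last first.
    by rewrite exprS mulrCA [X in _ * X]mulrA divff// mul1r -exprMn divff// expr1n.
  by rewrite !ler_pM2l ?exprn_gt0// ltW.
rewrite integral_nneseries//.
apply: (@le_lt_trans _ _ (\sum_(n <oo) ((C' * 2 ^+ d * 2) / (2 ^ n.+1)%:R)%:E)%E); last first.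
  apply: le_lt_trans (epsilon_trick0 _ _) _; last exact: ltry.
  by rewrite mulr_ge0// mulr_ge0// exprn_ge0.
apply: lee_nneseries => [n _ _|n _]; first by apply: integral_ge0.
rewrite /g; under eq_integral do rewrite EFinM.
rewrite ge0_integralZl//; last 2 first.
- apply/measurable_EFinP; apply: measurable_indic; exact: measurable_cube.
- by rewrite lee_fin mulr_ge0// exprn_ge0.
rewrite integral_indic ?setIT//; last exact: measurable_cube.
apply: (@le_trans _ _ ((C' * 2 ^+ (n * e))%:E * ((2 * 2^-1 ^+ n) ^+ d)%:E)%E).
  apply: lee_wpmul2l; first by rewrite lee_fin mulr_ge0// exprn_ge0.
  by apply: haar_cube; rewrite exprn_ge0.
rewrite -EFinM lee_fin -!(mulrA C'); apply: ler_wpM2l => //.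
rewrite exprMn mulrCA -mulrA; apply: ler_wpM2l; first by rewrite exprn_ge0.
rewrite natrX exprS invfM mulrA divff// mul1r -exprVn.
(* Of the [d] factors 2^-n in the measure of the cube, [e] cancel the growth of the pole, one is
   kept for the geometric series, and the others are at most 1. *)
rewrite (_ : d = (e + 1 + (d - e.+1))%N); last by rewrite addn1 subnKC.
rewrite !exprD expr1 !mulrA exprM.
rewrite [X in X * _ * _](_ : _ = 1) ?mul1r; last first.
  by rewrite -exprMn -exprMn divff// !expr1n.
rewrite ler_piMr ?exprn_ge0// -exprM exprn_ile1//; lra.
Qed.

Lemma integrable_bounded d (C : R) (h : d.-tuple R -> R) : (0 < d)%N ->
  measurable_fun setT h ->
  (forall a, @torus R d a -> a <> origin R d -> `|h a| <= C) ->
  (haar R d).-integrable setT (EFin \o h).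
Proof.
move=> d0 mh hC; apply: (@integrable_pole d 0 C) => // a ta a0.
by rewrite expr0 mulr1 hC.
Qed.

Lemma Rintegral_bounded d (C : R) (h : d.-tuple R -> R) : (0 < d)%N -> 0 <= C ->
  measurable_fun setT h ->
  (forall a, @torus R d a -> a <> origin R d -> `|h a| <= C) ->
  `| \int[haar R d]_a h a| <= C.
Proof.
move=> d0 C0 mh hC; have ih := integrable_bounded d0 mh hC.
rewrite -lee_fin EFin_normr_Rintegral//.
apply: le_trans (le_abse_integral _ _ _) _ => //; first exact/measurable_EFinP.
apply: (@le_trans _ _ (\int[haar R d]_a C%:E)%E).
  apply: ae_ge0_le_integral => //.
  - by apply: measurableT_comp => //; exact/measurable_EFinP.
  - by apply: ae_torus => // a ta a0 _; rewrite lee_fin hC.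
rewrite integral_cst// [X in (_ * X)%E](_ : _ = 1%E) ?mule1//; exact: probability_setT.
Qed.

End Poles.

(** * Complex parts, sine and cosine *)

Section ComplexParts.
Variable R : realType.
Implicit Types z w : R[i].

Lemma creD z w : complex.Re (z + w) = complex.Re z + complex.Re w.
Proof. by case: z w => [a b] [c d]. Qed.

Lemma cimD z w : complex.Im (z + w) = complex.Im z + complex.Im w.
Proof. by case: z w => [a b] [c d]. Qed.

Lemma creM z w : complex.Re (z * w) =
  complex.Re z * complex.Re w - complex.Im z * complex.Im w.
Proof. by case: z w => [a b] [c d]. Qed.

Lemma cimM z w : complex.Im (z * w) =
  complex.Re z * complex.Im w + complex.Im z * complex.Re w.
Proof. by case: z w => [a b] [c d]. Qed.

Lemma creN z : complex.Re (- z) = - complex.Re z.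
Proof. by case: z. Qed.

Lemma cimN z : complex.Im (- z) = - complex.Im z.
Proof. by case: z. Qed.

Lemma cre_sum I (r : seq I) (P : pred I) (F : I -> R[i]) :
  complex.Re (\sum_(i <- r | P i) F i) = \sum_(i <- r | P i) complex.Re (F i).
Proof. by apply: (big_morph _ creD). Qed.

Lemma cim_sum I (r : seq I) (P : pred I) (F : I -> R[i]) :
  complex.Im (\sum_(i <- r | P i) F i) = \sum_(i <- r | P i) complex.Im (F i).
Proof. by apply: (big_morph _ cimD). Qed.

Lemma cre_realM (c : R) z : complex.Re (c%:C * z) = c * complex.Re z.
Proof. by rewrite creM/= mul0r subr0. Qed.

Lemma cim_realM (c : R) z : complex.Im (c%:C * z) = c * complex.Im z.
Proof. by rewrite cimM/= mul0r addr0. Qed.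

Lemma complex_eqP z w :
  complex.Re z = complex.Re w -> complex.Im z = complex.Im w -> z = w.
Proof. by case: z w => [a b] [c d] /= -> ->. Qed.

End ComplexParts.

Section SinCos.
Variable R : realType.
Implicit Types x : R.

Lemma sin_le x : `|sin x| <= `|x|.
Proof.
wlog x0 : x / 0 <= x.
  move=> h; have [|x0] := leP 0 x; first exact: h.
  by have := h (- x); rewrite sinN !normrN; apply; rewrite oppr_ge0 ltW.
have [c _] : exists2 c, c \in `[0, x] & sin x - sin 0 = cos c * (x - 0).
  apply: (@MVT_segment _ sin cos) => //.
  by apply: continuous_subspaceT => y; exact: continuous_sin.
rewrite sin0 !subr0 => ->.
by rewrite normrM ler_piMl// cos_max.
Qed.

Lemma cosE_sin_half x : 1 - cos x = 2 * sin (x / 2) ^+ 2.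
Proof.
rewrite {1}(_ : x = (x / 2) *+ 2); last by rewrite -mulr_natr divfK.
by rewrite cos_mulr2n cos2sin2; ring.
Qed.

Lemma one_minus_cos_le x : 1 - cos x <= x ^+ 2.
Proof.
rewrite cosE_sin_half.
have : sin (x / 2) ^+ 2 <= (x / 2) ^+ 2 by rewrite -ler_sqrt ?sqr_ge0// !sqrtr_sqr sin_le.
by have := sqr_ge0 x; nra.
Qed.

(** A weak Jordan inequality. The mean value theorem gives [y * cos y <= sin y]; at [y = x / 2] the
    double angle formula turns this into [sin x >= x * cos (x / 2) ^+ 2], where the squared cosine
    is at least 1/2 because [cos x >= 0]. *)
Lemma sin_ge_half x : 0 <= x <= pi / 2 -> x / 2 <= sin x.
Proof.
have sc (y : R) : 0 <= y <= pi / 2 -> y * cos y <= sin y.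
  move=> /andP[y0 y1].
  have [c] : exists2 c, c \in `[0, y] & sin y - sin 0 = cos c * (y - 0).
    apply: (@MVT_segment _ sin cos) => //.
    by apply: continuous_subspaceT => z; exact: continuous_sin.
  rewrite in_itv/= => /andP[c0 c1]; rewrite sin0 !subr0 => ->; rewrite mulrC.
  apply: ler_wpM2r => //; rewrite leNgt; apply/negP.
  have pip := @pihalf_02 R.
  have -> : (cos c < cos y) = (y < c).
    by apply: ltr_cos; rewrite in_itv/=; apply/andP; split; lra.
  by rewrite ltNge c1.
move=> /andP[x0 x1].
have h1 : 0 <= x / 2 <= pi / 2 by apply/andP; split; lra.
have := sc _ h1.
have c0 : 0 <= cos (x / 2) by apply: cos_ge0_pihalf; apply/andP; split; lra.
have c2 : 1 / 2 <= cos (x / 2) ^+ 2.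
  have : 0 <= cos x by apply: cos_ge0_pihalf; apply/andP; split; lra.
  have := cosE_sin_half x; have := cos2sin2 (x / 2); lra.
rewrite [sin x](_ : _ = 2 * (cos (x / 2) * sin (x / 2))); last first.
  rewrite {1}(_ : x = (x / 2) *+ 2); last by rewrite -mulr_natr divfK.
  by rewrite sin_mulr2n mulr_natl.
move=> h2; apply: (@le_trans _ _ (2 * (cos (x / 2) * (x / 2 * cos (x / 2))))).
  rewrite (_ : 2 * _ = x * cos (x / 2) ^+ 2); last by field.
  by nra.
by rewrite ler_wpM2l// ler_wpM2l.
Qed.

Lemma one_minus_cos_ge (t : R) : `|t| <= 2^-1 -> t ^+ 2 <= 1 - cos (2 * pi * t).
Proof.
wlog t0 : t / 0 <= t.
  move=> h; have [|t0] := leP 0 t; first exact: h.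
  have := h (- t); rewrite mulrN cosN normrN sqrrN; apply.
  by rewrite oppr_ge0 ltW.
rewrite ger0_norm// => t1; rewrite cosE_sin_half.
have p2 := @pi_ge2 R.
rewrite (_ : 2 * pi * t / 2 = pi * t); last by field.
have h : pi * t / 2 <= sin (pi * t).
  apply: sin_ge_half; rewrite mulr_ge0 ?pi_ge0//=.
  by apply: ler_wpM2l => //; exact: pi_ge0.
have : t <= pi * t / 2 by nra.
by nra.
Qed.

Lemma sin_pi_int (n : int) : sin (pi * n%:~R) = 0 :> R.
Proof.
have h (m : nat) : sin (pi * m%:R) = 0 :> R.
  elim: m => [|m IH]; first by rewrite mulr0 sin0.
  by rewrite -natr1 mulrDr mulr1 sinD sinpi IH mul0r mulr0 addr0.
by case: n => n; [exact: h|rewrite NegzE mulrNz mulrN sinN h oppr0].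
Qed.

(** The summand 1 keeps the integrand nonnegative, so that the passage to Lebesgue measure needs no
    integrability. *)
Lemma cos_int_itv (n : int) :
  (\int[uniform_prob (@half_itv R)]_t (1 + cos (2 * pi * t * n%:~R))%:E
   = (1 + (n == 0)%:R)%:E)%E.
Proof.
have cc : continuous (fun t : R => cos (2 * pi * t * n%:~R)).
  move=> t; apply: continuous_comp; last exact: continuous_cos.
  apply: continuousM; last exact: cst_continuous.
  by apply: continuousM; [exact: cst_continuous|].
rewrite integral_uniformE; last 2 first.
- apply/measurable_EFinP; apply: measurable_funD => //.
  exact: continuous_measurable_fun.
- by move=> t; rewrite lee_fin -lerBlDl sub0r cos_geN1.
have [->|n0] := eqVneq n 0.
  under eq_integral do rewrite mulr0 cos0.
  rewrite integral_cst//= lebesgue_measure_itv/= lte_fin ifT; last by lra.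
  by rewrite -EFinD -EFinM; congr EFin; lra.
pose w : R := 2 * pi * n%:~R.
have w0 : w != 0 by rewrite !mulf_neq0// ?intr_eq0// gt_eqF// pi_gt0.
pose F t : R := t + w^-1 * sin (w * t).
have dF (t : R) : is_derive t 1 F (1 + cos (2 * pi * t * n%:~R)).
  apply: is_deriveD.
  rewrite (_ : cos _ = w^-1 *: (cos (w * t) * (w * 1))); last first.
    rewrite mulr1 /GRing.scale/= mulrCA mulVf// mulr1; congr cos.
    by rewrite /w; ring.
  apply: is_deriveZ.
rewrite (@continuous_FTC2 _ _ F) //; last 4 first.
- by lra.
- by apply: continuous_subspaceT => t; apply: continuousD; [exact: cst_continuous|exact: cc].
- have cF : continuous F.
    by move=> t; apply/differentiable_continuous/derivable1_diffP; case: (dF t).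
  split; first by move=> t _; case: (dF t).
  + by apply: cvg_at_right_filter; exact: cF.
  + by apply: cvg_at_left_filter; exact: cF.
- by move=> t _; rewrite derive1E; case: (dF t).
rewrite -EFinB addr0; congr EFin; rewrite /F.
have sw : sin (w * 2^-1) = 0.
  rewrite /w (_ : _ * _ = pi * n%:~R); last by field.
  exact: sin_pi_int.
rewrite mulrN sinN sw; lra.
Qed.

End SinCos.

(** * Trigonometric polynomials with real coefficients *)

Section Xi.
Variables (R : realType) (d : nat).
Implicit Types (a : d.-tuple R) (x y : 'rV[int]_d).

Lemma dotD a x y : dot a (x + y) = dot a x + dot a y.
Proof.
rewrite /dot -big_split/=; apply: eq_bigr => i _.
by rewrite mxE intrD mulrDr.
Qed.

Lemma dotN a x : dot a (- x) = - dot a x.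
Proof.
rewrite /dot -sumrN; apply: eq_bigr => i _.
by rewrite mxE mulrNz mulrN.
Qed.

Lemma dot_opp a x : dot (opp_tuple a) x = - dot a x.
Proof.
rewrite /dot -sumrN; apply: eq_bigr => i _.
by rewrite tnth_opp mulNr.
Qed.

Lemma dot_origin x : dot (origin R d) x = 0.
Proof. by rewrite /dot big1// => i _; rewrite tnth_origin mul0r. Qed.

Lemma dot0 a : dot a 0 = 0.
Proof. by rewrite /dot big1// => i _; rewrite mxE mulr0. Qed.

Lemma dot_unit a j : dot a (unit_vec j) = tnth a j.
Proof.
rewrite /dot (bigD1 j)//= big1 ?addr0 => [|i ij].
  by rewrite mxE !eqxx mulr1.
by rewrite mxE (negbTE ij) andbF mulr0.
Qed.

Lemma dot_le a x : `|dot a x| <= supn a * \sum_(i < d) `|(x 0 i)%:~R|.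
Proof.
apply: le_trans (ler_norm_sum _ _ _) _; rewrite mulr_sumr.
by apply: ler_sum => i _; rewrite normrM ler_wpM2r// tnth_le_supn.
Qed.

Lemma expi2piD (s t : R) : expi2pi (s + t) = expi2pi s * expi2pi t.
Proof.
apply: complex_eqP; rewrite /expi2pi ?creM ?cimM/= mulrDr ?cosD ?sinD//.
by rewrite addrC.
Qed.

Lemma xiD a x y : xi a (x + y) = xi a x * xi a y.
Proof. by rewrite /xi dotD expi2piD. Qed.

Lemma xi0 a : xi a 0 = 1.
Proof. by rewrite /xi dot0 /expi2pi mulr0 cos0 sin0. Qed.

Lemma xi_origin x : xi (origin R d) x = 1.
Proof. by rewrite /xi dot_origin /expi2pi mulr0 cos0 sin0. Qed.

Lemma xi_opp a x : xi (opp_tuple a) x = conjc (xi a x).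
Proof. by rewrite /xi dot_opp /expi2pi mulrN cosN sinN. Qed.

Lemma measurable_dot x : measurable_fun setT (fun a => dot a x).
Proof.
apply: measurable_sum => i; apply: measurable_funM => //.
exact: measurable_tnth.
Qed.

Lemma measurable_Re_xi x : measurable_fun setT (fun a => complex.Re (xi a x)).
Proof.
apply: (@measurableT_comp _ _ _ _ _ _ cos).
  exact: continuous_measurable_fun (@continuous_cos R).
by apply: measurable_funM => //; exact: measurable_dot.
Qed.

Lemma measurable_Im_xi x : measurable_fun setT (fun a => complex.Im (xi a x)).
Proof.
apply: (@measurableT_comp _ _ _ _ _ _ sin).
  exact: continuous_measurable_fun (@continuous_sin R).
by apply: measurable_funM => //; exact: measurable_dot.
Qed.

Lemma Re_xi_max a x : `|complex.Re (xi a x)| <= 1.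
Proof. exact: cos_max. Qed.

Lemma Im_xi_max a x : `|complex.Im (xi a x)| <= 1.
Proof. exact: sin_max. Qed.

Lemma xi_near_origin x : exists2 C, 0 <= C &
  forall a, `|complex.Re (xi a x) - 1| <= C * supn a ^+ 2 /\
            `|complex.Im (xi a x)| <= C * supn a.
Proof.
pose K : R := 2 * pi * \sum_(i < d) `|(x 0 i)%:~R|.
have K0 : 0 <= K by rewrite !mulr_ge0 ?pi_ge0 ?sumr_ge0.
have hK a : `|2 * pi * dot a x| <= K * supn a.
  rewrite normrM ger0_norm ?mulr_ge0 ?pi_ge0// /K -mulrA ler_wpM2l ?mulr_ge0 ?pi_ge0//.
  by rewrite mulrC dot_le.
exists (K + K ^+ 2); first by rewrite addr_ge0// sqr_ge0.
move=> a; have s0 := supn_ge0 a; have KK := sqr_ge0 K; split.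
- rewrite distrC ger0_norm ?subr_ge0 ?cos_le1//.
  apply: le_trans (one_minus_cos_le _) _.
  rewrite -real_normK ?num_real//.
  apply: (@le_trans _ _ ((K * supn a) ^+ 2)).
    apply: lerXn2r; [exact: normr_ge0|exact: mulr_ge0|exact: hK].
  by rewrite exprMn ler_wpM2r ?sqr_ge0// lerDr.
- apply: le_trans (sin_le _) _; apply: le_trans (hK a) _.
  by rewrite ler_wpM2r// lerDl.
Qed.

End Xi.

Section RealTrig.
Variables (R : realType) (d : nat).
Implicit Types (f g : d.-tuple R -> R[i]).

(** A list of coefficients and frequencies, repetitions allowed: sums are concatenations and
    products are lists of pairs, whence closure under determinants. *)
Definition realtrig f : Prop := exists s : seq (R * 'rV[int]_d),
  forall a, f a = \sum_(p <- s) p.1%:C * xi a p.2.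

Lemma realtrig_ext f g : f =1 g -> realtrig f -> realtrig g.
Proof. by move=> fg [s hs]; exists s => a; rewrite -fg. Qed.

Lemma realtrig_scale_xi (c : R) x : realtrig (fun a => c%:C * xi a x).
Proof. by exists [:: (c, x)] => a; rewrite big_seq1. Qed.

Lemma realtrig_xi x : realtrig (fun a => xi a x).
Proof. by apply: realtrig_ext (realtrig_scale_xi 1 x) => a; rewrite mul1r. Qed.

Lemma realtrig_cst (c : R) : realtrig (fun=> c%:C).
Proof. by apply: realtrig_ext (realtrig_scale_xi c 0) => a; rewrite xi0 mulr1. Qed.

Lemma realtrigD f g : realtrig f -> realtrig g -> realtrig (fun a => f a + g a).
Proof.
by move=> [s hs] [t ht]; exists (s ++ t) => a; rewrite hs ht big_cat.
Qed.

Lemma realtrigM f g : realtrig f -> realtrig g -> realtrig (fun a => f a * g a).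
Proof.
move=> [s hs] [t ht]; exists [seq (p.1 * q.1, p.2 + q.2) | p <- s, q <- t] => a.
rewrite hs ht big_allpairs_dep/= mulr_suml; apply: eq_bigr => p _.
rewrite mulr_sumr; apply: eq_bigr => q _ /=.
by rewrite xiD rmorphM/= mulrACA.
Qed.

Lemma realtrig_sum I (r : seq I) (P : pred I) (F : I -> d.-tuple R -> R[i]) :
  (forall i, P i -> realtrig (F i)) ->
  realtrig (fun a => \sum_(i <- r | P i) F i a).
Proof.
move=> h; elim: r => [|i r IH].
  by apply: realtrig_ext (realtrig_cst 0) => a; rewrite big_nil.
case: (boolP (P i)) => Pi.
  by apply: realtrig_ext (realtrigD (h i Pi) IH) => a; rewrite big_cons Pi.
by apply: realtrig_ext IH => a; rewrite big_cons (negbTE Pi).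
Qed.

Lemma realtrig_prod I (r : seq I) (P : pred I) (F : I -> d.-tuple R -> R[i]) :
  (forall i, P i -> realtrig (F i)) ->
  realtrig (fun a => \prod_(i <- r | P i) F i a).
Proof.
move=> h; elim: r => [|i r IH].
  by apply: realtrig_ext (realtrig_cst 1) => a; rewrite big_nil.
case: (boolP (P i)) => Pi.
  by apply: realtrig_ext (realtrigM (h i Pi) IH) => a; rewrite big_cons Pi.
by apply: realtrig_ext IH => a; rewrite big_cons (negbTE Pi).
Qed.

Lemma realtrigN f : realtrig f -> realtrig (fun a => - f a).
Proof.
move=> tf; apply: realtrig_ext (realtrigM (realtrig_cst (-1)) tf) => a.
by rewrite rmorphN1 mulN1r.
Qed.

Lemma measurable_Re_realtrig f : realtrig f ->
  measurable_fun setT (fun a => complex.Re (f a)).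
Proof.
move=> [s hs]; rewrite (_ : (fun a => _) =
    fun a => \sum_(p <- s) p.1 * complex.Re (xi a p.2)).
  apply: measurable_sum => p; apply: measurable_funM => //.
  exact: measurable_Re_xi.
by apply/funext => a; rewrite hs cre_sum; apply: eq_bigr => p _; rewrite cre_realM.
Qed.

Lemma measurable_Im_realtrig f : realtrig f ->
  measurable_fun setT (fun a => complex.Im (f a)).
Proof.
move=> [s hs]; rewrite (_ : (fun a => _) =
    fun a => \sum_(p <- s) p.1 * complex.Im (xi a p.2)).
  apply: measurable_sum => p; apply: measurable_funM => //.
  exact: measurable_Im_xi.
by apply/funext => a; rewrite hs cim_sum; apply: eq_bigr => p _; rewrite cim_realM.
Qed.

Lemma realtrig_opp f a : realtrig f -> f (opp_tuple a) = conjc (f a).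
Proof.
move=> [s hs]; rewrite !hs rmorph_sum; apply: eq_bigr => p _.
by rewrite xi_opp (rmorphM conjc); congr (_ * _); exact/esym/conjc_real.
Qed.

(* Real coefficients make the real part even, whence the quadratic error. *)
Lemma realtrig_near_origin f : realtrig f -> exists2 C, 0 <= C & forall a,
  `|complex.Re (f a) - complex.Re (f (origin R d))| <= C * supn a ^+ 2 /\
  `|complex.Im (f a)| <= C * supn a.
Proof.
move=> [s]; elim: s f => [|p s IH] f hs.
  exists 0 => // a; rewrite !hs !big_nil/= subrr normr0 !mul0r//.
have [C C0 hC] := IH _ (fun a => erefl).
have [K K0 hK] := xi_near_origin R p.2.
exists (`|p.1| * K + C); first by rewrite addr_ge0// mulr_ge0.
move=> a; rewrite !hs !big_cons !creD !cimD !cre_realM !cim_realM.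
have [h1 h2] := hK a; have [h3 h4] := hC a; rewrite xi_origin; split.
- rewrite opprD addrACA -mulrBr mulrDl.
  apply: le_trans (ler_normD _ _) _; apply: lerD => //.
  by rewrite normrM -mulrA ler_wpM2l.
- rewrite mulrDl; apply: le_trans (ler_normD _ _) _; apply: lerD => //.
  by rewrite normrM -mulrA ler_wpM2l.
Qed.

Lemma realtrig_bounded f : realtrig f -> exists2 C, 0 <= C & forall a,
  `|complex.Re (f a)| <= C /\ `|complex.Im (f a)| <= C.
Proof.
move=> [s]; elim: s f => [|p s IH] f hs.
  by exists 0 => // a; rewrite !hs !big_nil/= normr0.
have [C C0 hC] := IH _ (fun a => erefl).
exists (`|p.1| + C); first by rewrite addr_ge0.
move=> a; rewrite !hs !big_cons !creD !cimD !cre_realM !cim_realM.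
have [h3 h4] := hC a; split; apply: le_trans (ler_normD _ _) _; apply: lerD => //.
- by rewrite normrM ler_piMr// Re_xi_max.
- by rewrite normrM ler_piMr// Im_xi_max.
Qed.

End RealTrig.

(** * Orthogonality of the characters of the torus *)

Section CharacterIntegrals.
Variable R : realType.

Lemma haar_bounded_integrable d (C : R) (h : d.-tuple R -> R) :
  measurable_fun setT h -> (forall a, `|h a| <= C) ->
  (haar R d).-integrable setT (EFin \o h).
Proof.
move=> mh hC; apply: measurable_bounded_integrable => //.
- rewrite (le_lt_trans (probability_le1 _ _))//; exact: ltry.
- exists C; split; first exact: num_real.
  by move=> x Cx a _; exact: le_trans (hC a) (ltW Cx).
Qed.

Section RealIntegrable.
Variable d : nat.
Local Notation haar_integrable f := ((haar R d).-integrable setT (EFin \o f)).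
Implicit Types f g : d.-tuple R -> R.

Lemma haar_integrableZ f (c : R) :
  haar_integrable f -> haar_integrable (fun a => c * f a).
Proof. by move=> fi; exact: (integrableZl measurableT c fi). Qed.

Lemma haar_integrableD f g : haar_integrable f -> haar_integrable g ->
  haar_integrable (fun a => f a + g a).
Proof. by move=> fi gi; exact: (integrableD measurableT fi gi). Qed.

Lemma haar_integrableB f g : haar_integrable f -> haar_integrable g ->
  haar_integrable (fun a => f a - g a).
Proof. by move=> fi gi; exact: (integrableB measurableT fi gi). Qed.

End RealIntegrable.

(** An odd function integrates to 0 against a symmetric measure. *)
Lemma integral_Im_xi d (x : 'rV[int]_d) :
  \int[haar R d]_a complex.Im (xi a x) = 0.
Proof.
have := Rintegral_haarN (@measurable_Im_xi R d x).
under eq_Rintegral do rewrite xi_opp.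
have ii : (haar R d).-integrable setT (EFin \o (fun a => complex.Im (xi a x))).
  apply: (@haar_bounded_integrable _ 1); [exact: measurable_Im_xi|move=> a; exact: Im_xi_max].
rewrite (_ : (fun a => _) = fun a : d.-tuple R => -1 * complex.Im (xi a x)); last first.
  by apply/funext => a; case: (xi a x) => p q /=; rewrite mulN1r.
rewrite RintegralZl//; lra.
Qed.

Lemma integrable_Re_xi d (x : 'rV[int]_d) :
  (haar R d).-integrable setT (EFin \o (fun a => complex.Re (xi a x))).
Proof.
by apply: (@haar_bounded_integrable _ 1); [exact: measurable_Re_xi|move=> a; exact: Re_xi_max].
Qed.

Lemma integrable_Im_xi d (x : 'rV[int]_d) :
  (haar R d).-integrable setT (EFin \o (fun a => complex.Im (xi a x))).
Proof.
by apply: (@haar_bounded_integrable _ 1); [exact: measurable_Im_xi|move=> a; exact: Im_xi_max].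
Qed.

Lemma integrable_haar_cst d (c : R) : (haar R d).-integrable setT (EFin \o (fun=> c)).
Proof. exact: (@haar_bounded_integrable _ `|c|). Qed.

Lemma Rintegral_haar_cst d (c : R) : \int[haar R d]_a c = c.
Proof.
rewrite Rintegral_cst// [X in fine X](_ : _ = 1%E) ?mulr1//; exact: probability_setT.
Qed.

Lemma EFin_Rintegral d (f : d.-tuple R -> R) : (haar R d).-integrable setT (EFin \o f) ->
  (\int[haar R d]_a (f a)%:E)%E = (\int[haar R d]_a f a)%:E.
Proof. by move=> fi; rewrite /Rintegral fineK//; exact: integrable_fin_num. Qed.

(** Induction on [d], peeling off the first coordinate. Tonelli is applied to [1 + Re], which is
    nonnegative; [red] removes the 1 again. The real part of the product of characters also produces
    imaginary parts, which [integral_Im_xi] kills. *)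
Lemma integral_Re_xi d (x : 'rV[int]_d) :
  \int[haar R d]_a complex.Re (xi a x) = (x == 0)%:R.
Proof.
have red d' (z : 'rV[int]_d') : (\int[haar R d']_a (1 + complex.Re (xi a z))%:E =
    (1 + (z == 0)%:R)%:E)%E -> \int[haar R d']_a complex.Re (xi a z) = (z == 0)%:R.
  move=> h; have : \int[haar R d']_a (1 + complex.Re (xi a z)) = 1 + (z == 0)%:R.
    by rewrite /Rintegral h.
  rewrite RintegralD//; [|exact: integrable_haar_cst|exact: integrable_Re_xi].
  by rewrite Rintegral_haar_cst => /addrI.
elim: d x => [|d IH] x.
  rewrite (_ : x = 0) ?eqxx; last by apply/matrixP => i [].
  under eq_Rintegral do rewrite xi0.
  exact: Rintegral_haar_cst.
apply: red.
pose y : 'rV[int]_d := \row_i x 0 (lift ord0 i).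
have xic t b : xi (cons_pair (t, b)) x = expi2pi (t * (x 0 ord0)%:~R) * xi b y.
  rewrite /xi -expi2piD; congr expi2pi; rewrite /dot big_ord_recl.
  by congr (_ + _); apply: eq_bigr => i _; rewrite mxE tnthS.
have m1 : measurable_fun setT (fun a : d.+1.-tuple R => (1 + complex.Re (xi a x))%:E).
  by apply/measurable_EFinP; apply: measurable_funD => //; exact: measurable_Re_xi.
have p1 (a : d.+1.-tuple R) : (0 <= (1 + complex.Re (xi a x))%:E)%E.
  by rewrite lee_fin -lerBlDl sub0r cos_geN1.
rewrite /= ge0_integral_distribution// fubini_tonelli1//=; last first.
  by apply: measurableT_comp => //; exact: measurable_cons_pair.
transitivity (\int[uniform_prob (@half_itv R)]_t
   (1 + (y == 0)%:R * cos (2 * pi * t * (x 0 ord0)%:~R))%:E)%E.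
  apply: eq_integral => t _; rewrite /fubini_F/=.
  set A : R[i] := expi2pi (t * (x 0 ord0)%:~R).
  transitivity (\int[haar R d]_b (1 + (complex.Re A * complex.Re (xi b y) -
      complex.Im A * complex.Im (xi b y)))%:E)%E.
    by apply: eq_integral => b _; rewrite -creM -xic.
  have iR : (haar R d).-integrable setT (EFin \o (fun b => complex.Re A * complex.Re (xi b y))).
    exact: haar_integrableZ (integrable_Re_xi _).
  have iI : (haar R d).-integrable setT (EFin \o (fun b => complex.Im A * complex.Im (xi b y))).
    exact: haar_integrableZ (integrable_Im_xi _).
  have iB : (haar R d).-integrable setT (EFin \o (fun b =>
      complex.Re A * complex.Re (xi b y) - complex.Im A * complex.Im (xi b y))).
    exact: haar_integrableB.
  rewrite EFin_Rintegral; last exact: (haar_integrableD (integrable_haar_cst d 1) iB).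
  rewrite RintegralD//; last exact: integrable_haar_cst.
  rewrite RintegralB// !RintegralZl//; [|exact: integrable_Im_xi|exact: integrable_Re_xi].
  rewrite integral_Im_xi IH Rintegral_haar_cst mulr0 subr0 mulrC.
  by rewrite /A /expi2pi/= mulrA.
have [y0|y0] := eqVneq y 0.
  under eq_integral do rewrite mul1r.
  rewrite cos_int_itv; congr (1 + _%:R)%:E; congr nat_of_bool.
  apply/eqP/eqP => [x0|->]; last by rewrite mxE.
  apply/matrixP => i j; rewrite ord1 mxE.
  case: (unliftP ord0 j) => [j' ->|->] //.
  by have /matrixP/(_ 0 j') := y0; rewrite !mxE.
under eq_integral do rewrite mul0r addr0.
rewrite integral_cst// [X in (_ * X)%E](_ : _ = 1%E) ?mule1//; last exact: probability_setT.
have -> : (x == 0) = false; last by rewrite addr0.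
apply/negbTE; apply: contra y0 => /eqP x0.
by apply/eqP/matrixP => i j; rewrite !mxE x0 mxE.
Qed.

End CharacterIntegrals.

(** * Quotients of trigonometric polynomials *)

Section Measurability.
Variable R : realType.

(** Writing 1/x as x/x^2 moves the inverse to a nonnegative base, where it is the measurable power
    [powR] of exponent -1; at 0 both sides take the default value 0. *)
Lemma measurable_realinv : measurable_fun setT (fun x : R => x^-1).
Proof.
rewrite (_ : (fun x : R => x^-1) = fun x => x * (x ^+ 2) `^ (-1)); last first.
  apply/funext => x; rewrite powR_inv1 ?sqr_ge0//.
  have [->|x0] := eqVneq x 0; first by rewrite invr0 mul0r.
  by rewrite expr2 invfM mulrA divff// mul1r.
apply: measurable_funM => //.
apply: (@measurableT_comp _ _ _ _ _ _ (fun y => y `^ (-1))); first exact: measurable_powR.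
exact: measurable_funX.
Qed.

Lemma measurable_fun_div d (T : measurableType d) (f g : T -> R) :
  measurable_fun setT f -> measurable_fun setT g ->
  measurable_fun setT (fun a => f a / g a).
Proof.
move=> mf mg; apply: measurable_funM => //.
by apply: measurableT_comp => //; exact: measurable_realinv.
Qed.

End Measurability.

(** * Dimension one: Chebyshev polynomials and the conjugate Dirichlet kernel *)

Section OneDim.
Variable R : realType.
Implicit Types (a : 1.-tuple R) (x : 'rV[int]_1) (n : nat).

Let theta a : R := 2 * pi * tnth a ord0.

(** The witnesses are the Chebyshev polynomials T_n and U_(n-1), built by the addition formulas.
    They turn the order of vanishing at the origin into divisibility by [1 - y] with [y] the
    cosine. *)
Lemma chebyshev n : exists p q : {poly R}, forall y : R,
  cos (y * n%:R) = p.[cos y] /\ sin (y * n%:R) = sin y * q.[cos y].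
Proof.
elim: n => [|n [p [q h]]].
  by exists 1, 0 => y; rewrite mulr0 cos0 sin0 hornerC horner0 mulr0.
exists (p * 'X - (1 - 'X ^+ 2) * q), (q * 'X + p) => y.
have [h1 h2] := h y; rewrite -natr1 mulrDr mulr1 cosD sinD h1 h2 !hornerE; split.
- by rewrite -sin2cos2; ring.
- by ring.
Qed.

Lemma dot_dim1 a x : dot a x = tnth a ord0 * (x 0 0)%:~R.
Proof. by rewrite /dot big_ord1. Qed.

Lemma chebyshev_realtrig (f : 1.-tuple R -> R[i]) : realtrig f ->
  exists p q : {poly R}, forall a,
  complex.Re (f a) = p.[cos (theta a)] /\
  complex.Im (f a) = sin (theta a) * q.[cos (theta a)].
Proof.
move=> [s]; elim: s f => [|z s IH] f hs.
  by exists 0, 0 => a; rewrite hs big_nil !horner0 mulr0.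
have [p [q h]] := IH _ (fun a => erefl).
have [p' [q' h']] : exists p q : {poly R}, forall a,
    complex.Re (xi a z.2) = p.[cos (theta a)] /\
    complex.Im (xi a z.2) = sin (theta a) * q.[cos (theta a)].
  have xiE a : 2 * pi * dot a z.2 = theta a * (z.2 0 0)%:~R.
    by rewrite dot_dim1 mulrA.
  rewrite /xi /expi2pi/=; case: (z.2 0 0) xiE => n xiE.
    have [p1 [q1 h1]] := chebyshev n; exists p1, q1 => a.
    by rewrite xiE.
  have [p1 [q1 h1]] := chebyshev n.+1; exists p1, (- q1) => a.
  rewrite xiE NegzE mulrNz mulrN cosN sinN hornerN mulrN.
  by have [-> ->] := h1 (theta a).
exists (z.1%:P * p' + p), (z.1%:P * q' + q) => a.
rewrite hs big_cons creD cimD cre_realM cim_realM !hornerE.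
have [-> ->] := h a; have [-> ->] := h' a; split=> //; ring.
Qed.

Lemma poly_bounded (p : {poly R}) : exists2 C, 0 <= C &
  forall y : R, `|y| <= 1 -> `|p.[y]| <= C.
Proof.
exists (\sum_(i < size p) `|p`_i|); first by rewrite sumr_ge0.
move=> y y1; rewrite horner_coef; apply: le_trans (ler_norm_sum _ _ _) _.
apply: ler_sum => i _; rewrite normrM ler_piMr// normrX exprn_ile1//.
Qed.

Lemma poly_factor1 (p : {poly R}) : p.[1] = 0 ->
  exists r : {poly R}, forall y : R, p.[y] = (1 - y) * r.[y].
Proof.
move=> /eqP p1; have /factor_theorem[q qE] : root p 1 by [].
by exists (- q) => y; rewrite qE !hornerE; ring.
Qed.

Lemma supn_dim1 a : supn a = `|tnth a ord0|.
Proof.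
apply/eqP; rewrite eq_le tnth_le_supn andbT; apply/supn_le => // i.
by rewrite (ord1 i).
Qed.

Lemma one_minus_cos_theta a : @torus R 1 a -> a <> origin R 1 -> 0 < 1 - cos (theta a).
Proof.
move=> ta a0; have := supn_gt0 a0; have := supn_torus ta; rewrite supn_dim1 => h1 h0.
apply: lt_le_trans (one_minus_cos_ge h1); rewrite -real_normK ?num_real//.
by rewrite exprn_gt0.
Qed.

(* The kernel [sin y sin (n y) / (1 - cos y)] is a conjugate Dirichlet kernel:
   it telescopes to a trigonometric polynomial of mean 0 or 1. *)
Lemma conj_dirichlet (y : R) n : 1 - cos y != 0 ->
  sin y * sin (y * n%:R) / (1 - cos y) =
  \sum_(k < n) (cos (y * k%:R) + cos (y * k.+1%:R)).
Proof.
move=> y0; elim: n => [|n IH]; first by rewrite big_ord0 mulr0 sin0 mulr0 mul0r.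
rewrite big_ord_recr/= -IH -natr1 mulrDr mulr1 sinD cosD.
apply: (mulIf y0); rewrite mulrDl !divfK//.
by rewrite mulrDr [X in _ + X]mulrCA -expr2 sin2cos2; ring.
Qed.

Lemma theta_xi a n : theta a * n%:R = 2 * pi * dot a (const_mx n%:Z).
Proof. by rewrite dot_dim1 mxE -!mulrA. Qed.

Lemma measurable_theta : measurable_fun setT theta.
Proof. by apply: measurable_funM => //; exact: measurable_tnth. Qed.

Lemma measurable_cos_theta : measurable_fun setT (fun a => cos (theta a)).
Proof.
apply: (@measurableT_comp _ _ _ _ _ _ cos); last exact: measurable_theta.
exact: continuous_measurable_fun (@continuous_cos R).
Qed.

Lemma measurable_sin_theta : measurable_fun setT (fun a => sin (theta a)).
Proof.
apply: (@measurableT_comp _ _ _ _ _ _ sin); last exact: measurable_theta.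
exact: continuous_measurable_fun (@continuous_sin R).
Qed.

Definition conj_kernel x a : R :=
  sin (theta a) * complex.Im (xi a x) / (1 - cos (theta a)).

Lemma measurable_conj_kernel x : measurable_fun setT (conj_kernel x).
Proof.
apply: measurable_fun_div.
  by apply: measurable_funM; [exact: measurable_sin_theta|exact: measurable_Im_xi].
by apply: measurable_funB => //; exact: measurable_cos_theta.
Qed.

Let dirichlet n a : R := \sum_(k < n)
  (complex.Re (xi a (const_mx k%:Z)) + complex.Re (xi a (const_mx k.+1%:Z))).

Let dirichletE n a : @torus R 1 a -> a <> origin R 1 ->
  conj_kernel (const_mx n%:Z) a = dirichlet n a.
Proof.
move=> ta a0; have := one_minus_cos_theta ta a0 => /lt0r_neq0 h.
rewrite /conj_kernel /xi/= -theta_xi conj_dirichlet//.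
by apply: eq_bigr => k _; rewrite /= -!theta_xi.
Qed.

Let integrable_dirichlet n : (haar R 1).-integrable setT (EFin \o dirichlet n).
Proof.
rewrite (_ : _ \o _ = (fun a => \sum_(k < n) (complex.Re (xi a (const_mx k%:Z)) +
    complex.Re (xi a (const_mx k.+1%:Z)))%:E)%E); last first.
  by apply/funext => a /=; rewrite sumEFin.
apply: integrable_sum => // k _.
by apply: haar_integrableD; exact: integrable_Re_xi.
Qed.

Let integral_dirichlet n : \int[haar R 1]_a dirichlet n a = (0 < n)%:R.
Proof.
elim: n => [|n IH].
  rewrite (_ : dirichlet 0 = cst 0) ?Rintegral_haar_cst//.
  by apply/funext => a; rewrite /dirichlet big_ord0.
rewrite (_ : dirichlet n.+1 = fun a => dirichlet n a +
  (complex.Re (xi a (const_mx n%:Z)) + complex.Re (xi a (const_mx n.+1%:Z)))); last first.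
  by apply/funext => a; rewrite /dirichlet big_ord_recr.
rewrite RintegralD//; last by apply: haar_integrableD; exact: integrable_Re_xi.
rewrite RintegralD//; [|exact: integrable_Re_xi|exact: integrable_Re_xi].
have c0 (m : nat) : (const_mx m%:Z == 0 :> 'rV[int]_1) = (m == 0)%N.
  apply/eqP/eqP => [/matrixP/(_ 0 0)|->]; first by rewrite !mxE => -[].
  by apply/matrixP => i j; rewrite !mxE.
by rewrite IH !integral_Re_xi !c0; case: n {IH} => [|n] /=; rewrite ?addr0 ?add0r.
Qed.

Lemma conj_kernel_opp x a : conj_kernel (- x) a = - conj_kernel x a.
Proof. by rewrite /conj_kernel /xi/= dotN mulrN sinN mulrN mulNr. Qed.

(** Only the frequency 0 of the telescoped sum survives integration, so the bound does not depend on
    [x]. Absolute values would lose this: the L1 norm of the kernel grows logarithmically with the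
    frequency. *)
Lemma conj_kernel_integral x :
  (haar R 1).-integrable setT (EFin \o conj_kernel x) /\
  `| \int[haar R 1]_a conj_kernel x a | <= 1.
Proof.
have hn n : (haar R 1).-integrable setT (EFin \o conj_kernel (const_mx n%:Z)) /\
  `| \int[haar R 1]_a conj_kernel (const_mx n%:Z) a | <= 1.
  have mc := measurable_conj_kernel (const_mx n%:Z).
  have md : measurable_fun setT (dirichlet n).
    by have /measurable_int/measurable_EFinP := integrable_dirichlet n.
  split; last first.
    rewrite (ae_Rintegral _ mc md) ?integral_dirichlet//; last exact: dirichletE.
    by case: n {mc md} => [|n]; rewrite ?normr0 ?normr1.
  apply: (@integrable_bounded _ _ (\sum_(k < n) (1 + 1))) => // a ta a0.
  rewrite dirichletE//; apply: le_trans (ler_norm_sum _ _ _) _.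
  apply: ler_sum => k _; apply: le_trans (ler_normD _ _) _.
  by apply: lerD; exact: Re_xi_max.
have xE : x = const_mx (x 0 0) by apply/matrixP => i j; rewrite !ord1 mxE.
rewrite xE; case: (x 0 0) => n; first exact: hn.
rewrite NegzE (_ : const_mx _ = - const_mx (n.+1%:Z)); last first.
  by apply/matrixP => i j; rewrite !mxE.
have [h1 h2] := hn n.+1.
rewrite (_ : conj_kernel _ = fun a => -1 * conj_kernel (const_mx n.+1%:Z) a); last first.
  by apply/funext => a; rewrite conj_kernel_opp mulN1r.
split; first exact: haar_integrableZ.
by rewrite RintegralZl// mulN1r normrN.
Qed.

(** With [y] the cosine, [Im f] is the sine times [q(y)] and [Re g] is [(1 - y) r(y)], with
    [r(1) != 0] because [g] vanishes only to second order. So [kappa = q(1) / r(1)] is the residue: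
    [q / r - kappa] has a factor [1 - y] that cancels the denominator. *)
Lemma sine_over_det_dim1 (f g : 1.-tuple R -> R[i]) (c : R) :
  realtrig f -> realtrig g -> 0 < c ->
  complex.Re (g (origin R 1)) = 0 ->
  (forall a, @torus R 1 a -> c * supn a ^+ 2 <= complex.Re (g a)) ->
  exists kappa C : R, 0 <= C /\ forall x a, @torus R 1 a -> a <> origin R 1 ->
  `| complex.Im (f a) * complex.Im (xi a x) / complex.Re (g a)
     - kappa * conj_kernel x a | <= C.
Proof.
move=> tf tg c0 g0 gc.
have [pf [q hq]] := chebyshev_realtrig tf.
have [pg [qg hg]] := chebyshev_realtrig tg.
have theta0 : cos (theta (origin R 1)) = 1 by rewrite /theta tnth_origin mulr0 cos0.
have pg1 : pg.[1] = 0 by have := (hg (origin R 1)).1; rewrite g0 theta0.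
have [r hr] := poly_factor1 pg1.
pose c1 := c / (4 * pi ^+ 2).
have pi2 : 0 < 4 * pi ^+ 2 :> R by rewrite mulr_gt0// exprn_gt0// pi_gt0.
have c10 : 0 < c1 by rewrite divr_gt0.
have y_le a : 1 - cos (theta a) <= 4 * pi ^+ 2 * supn a ^+ 2.
  apply: le_trans (one_minus_cos_le _) _; rewrite supn_dim1 real_normK ?num_real//.
  by rewrite /theta le_eqVlt; apply/orP; left; apply/eqP; ring.
have rc a : @torus R 1 a -> a <> origin R 1 -> c1 <= r.[cos (theta a)].
  move=> ta a0; have y0 := one_minus_cos_theta ta a0.
  rewrite -(ler_pM2l y0) -hr -(hg a).1; apply: le_trans (gc a ta).
  rewrite /c1 mulrC -mulrA; apply: ler_wpM2l; first exact: ltW.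
  by rewrite ler_pdivrMl.
have r1 : r.[1] != 0.
  apply/eqP => r10; have [w hw] := poly_factor1 r10.
  have [W W0 hW] := poly_bounded w.
  (* An explicit point instead of a limit. If [r] vanished at 1, then [r.[cos (theta a)]] would be
     at most [4 * pi ^+ 2 * t ^+ 2 * W] at the point [t]. This [t] makes that smaller than [c1], and
     the term [2 * c1] in the denominator keeps [t] below 1/2, inside the torus. *)
  pose t := c1 / (2 * c1 + 4 * pi ^+ 2 * (W + 1)).
  have den : 0 < 2 * c1 + 4 * pi ^+ 2 * (W + 1) by nra.
  have t0 : 0 < t by rewrite divr_gt0.
  have t1 : t < 2^-1.
    rewrite /t ltr_pdivrMr//; nra.
  pose a : 1.-tuple R := [tuple t].
  have aE : tnth a ord0 = t by [].
  have ta : @torus R 1 a by move=> i; rewrite (ord1 i) aE; apply/andP; split; lra.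
  have a0 : a <> origin R 1.
    by move=> h; move: t0; rewrite -aE h tnth_origin ltxx.
  have := rc a ta a0; rewrite hw leNgt => /negP; apply.
  have w1 : w.[cos (theta a)] <= W by apply: le_trans (ler_norm _) _; apply: hW; exact: cos_max.
  have y0 := one_minus_cos_theta ta a0.
  have y1 := y_le a; rewrite supn_dim1 aE ger0_norm ?(ltW t0)// in y1.
  have tden : t * (2 * c1 + 4 * pi ^+ 2 * (W + 1)) = c1 by rewrite divfK// gt_eqF.
  apply: (@le_lt_trans _ _ (4 * pi ^+ 2 * t ^+ 2 * W)).
    by apply: (@le_trans _ _ ((1 - cos (theta a)) * W)); [apply: ler_wpM2l => //; exact: ltW|exact: ler_wpM2r].
  have tt : t ^+ 2 <= t by rewrite expr2; nra.
  nra.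
have [h hh] : exists h : {poly R}, forall y : R,
    q.[y] * r.[1] - q.[1] * r.[y] = (1 - y) * h.[y].
  have [|h hE] := @poly_factor1 (q * r.[1]%:P - q.[1]%:P * r).
    by rewrite !hornerE subrr.
  by exists h => y; rewrite -hE !hornerE.
have [H H0 hH] := poly_bounded h.
exists (q.[1] / r.[1]), (H / (c1 * `|r.[1]|)); split.
  by rewrite divr_ge0// mulr_ge0// ltW.
move=> x a ta a0; have y0 := one_minus_cos_theta ta a0; have rca := rc a ta a0.
rewrite (hq a).2 (hg a).1 hr /conj_kernel.
set s := sin (theta a); set sn := complex.Im _; set y := cos (theta a) in y0 rca *.
have ry0 : 0 < r.[y] by apply: lt_le_trans rca.
rewrite (_ : _ - _ = s * sn * h.[y] / (r.[y] * r.[1])); last first.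
  have -> : h.[y] = (q.[y] * r.[1] - q.[1] * r.[y]) / (1 - y).
    by rewrite hh mulrC mulKf// gt_eqF.
  by field; rewrite r1 !gt_eqF.
rewrite normrM normfV [in X in _ / X]normrM [X in _ / (X * _)]gtr0_norm//.
apply: ler_pM; [by []|by rewrite invr_ge0 mulr_ge0// ltW| |]; last first.
- have nr1 : 0 < `|r.[1]| by rewrite normr_gt0.
  by rewrite lef_pV2 ?posrE ?(mulr_gt0 c10) ?(mulr_gt0 ry0)// ler_wpM2r.
- rewrite !normrM -[H]mul1r; apply: ler_pM => //; last by apply: hH; exact: cos_max.
  by rewrite -[1]mulr1; apply: ler_pM => //; [exact: sin_max|exact: Im_xi_max].
Qed.

End OneDim.

Section BoundedCharacters.
Variables (R : realType) (d : nat).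

(* Away from dimension 1 the sine part is [O(1/supn a)], hence integrable; in
   dimension 1 it is a multiple of the conjugate Dirichlet kernel up to [O(1)]. *)
Lemma realtrig_quotient_bounded (f g : d.-tuple R -> R[i]) (c : R) :
  (0 < d)%N -> realtrig f -> realtrig g -> 0 < c ->
  complex.Re (g (origin R d)) = 0 ->
  (forall a, @torus R d a -> c * supn a ^+ 2 <= complex.Re (g a)) ->
  (haar R d).-integrable setT
    (EFin \o (fun a => complex.Re (f a) / complex.Re (g a))) ->
  exists2 B, 0 <= B & forall x,
  (haar R d).-integrable setT
    (EFin \o (fun a => complex.Re (f a * xi a x) / complex.Re (g a))) ->
  `| \int[haar R d]_a (complex.Re (f a * xi a x) / complex.Re (g a)) | <= B.
Proof.
move=> d0 tf tg c0 g0 gc if0.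
have mRf := measurable_Re_realtrig tf; have mIf := measurable_Im_realtrig tf.
have mRg := measurable_Re_realtrig tg.
pose F a := complex.Re (f a) / complex.Re (g a).
pose H a := complex.Im (f a) / complex.Re (g a).
have mF : measurable_fun setT F by exact: measurable_fun_div.
have mH : measurable_fun setT H by exact: measurable_fun_div.
have split_xi x : (fun a => complex.Re (f a * xi a x) / complex.Re (g a)) =
    fun a => F a * complex.Re (xi a x) - H a * complex.Im (xi a x).
  by apply/funext => a; rewrite creM /F /H; ring.
have dominated (K : d.-tuple R -> R) (e : d.-tuple R -> R) :
    measurable_fun setT K -> measurable_fun setT e -> (forall a, `|e a| <= 1) ->
    (haar R d).-integrable setT (EFin \o K) ->
    (haar R d).-integrable setT (EFin \o (fun a => K a * e a)) /\
    `| \int[haar R d]_a (K a * e a) | <= \int[haar R d]_a `|K a|.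
  move=> mK me e1 iK.
  have iKe : (haar R d).-integrable setT (EFin \o (fun a => K a * e a)).
    apply: le_integrable iK => //.
      by apply/measurable_EFinP; exact: measurable_funM.
    by move=> a _ /=; rewrite lee_fin normrM ler_piMr.
  split=> //; apply: le_trans (le_normr_Rintegral _ _) _ => //.
  apply: le_Rintegral => //.
  - exact: integrable_norm.
  - exact: integrable_norm.
  - by move=> a _; rewrite normrM ler_piMr.
have hF x := dominated F _ mF (measurable_Re_xi x) (fun a => Re_xi_max a x) if0.
have intF0 : 0 <= \int[haar R d]_a `|F a| by apply: Rintegral_ge0.
have [d1|d2] := ltnP 1 d.
  have iH : (haar R d).-integrable setT (EFin \o H).
    have [C C0 hC] := realtrig_near_origin tf.
    apply: (@integrable_pole _ _ 1 (C / c)) => // a ta a0.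
    have s0 := supn_gt0 a0; have gca := gc a ta.
    have gp : 0 < complex.Re (g a).
      by apply: lt_le_trans gca; rewrite mulr_gt0// exprn_gt0.
    rewrite /H expr1 normrM normfV (gtr0_norm gp) mulrAC ler_pdivrMr// mulrAC ler_pdivlMr//.
    have [_ h] := hC a.
    apply: (@le_trans _ _ (C * (c * supn a ^+ 2))); last exact: ler_wpM2l.
    rewrite (_ : C * _ = C * supn a * supn a * c); last by ring.
    by apply: ler_wpM2r; [exact: ltW|apply: ler_wpM2r => //; exact: ltW].
  have hH x := dominated H _ mH (measurable_Im_xi x) (fun a => Im_xi_max a x) iH.
  exists (\int[haar R d]_a `|F a| + \int[haar R d]_a `|H a|).
    by rewrite addr_ge0//; apply: Rintegral_ge0.
  move=> x _; rewrite split_xi RintegralB//; [|exact: (hF x).1|exact: (hH x).1].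
  apply: le_trans (ler_normB _ _) _; apply: lerD; [exact: (hF x).2|exact: (hH x).2].
have {d0 d2} d1 : d = 1%N by apply/eqP; rewrite eqn_leq d2.
subst d.
have [kappa [C [C0 hC]]] := sine_over_det_dim1 tf tg c0 g0 gc.
exists (\int[haar R 1]_a `|F a| + (`|kappa| + C)).
  by rewrite !addr_ge0.
move=> x ix; rewrite split_xi in ix *.
have [iFx bFx] := hF x; have [iKx bKx] := conj_kernel_integral R x.
(* [H] alone may have a pole of order 1, so its product with the sine is recovered as a difference
   of two integrable functions, one of them the integrand assumed integrable. *)
have iHx : (haar R 1).-integrable setT (EFin \o (fun a : 1.-tuple R => H a * complex.Im (xi a x))).
  rewrite (_ : (fun a : 1.-tuple R => H a * _) = fun a : 1.-tuple R => F a * complex.Re (xi a x) -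
     (F a * complex.Re (xi a x) - H a * complex.Im (xi a x))); last first.
    by apply/funext => a; ring.
  exact: haar_integrableB.
rewrite RintegralB//; apply: le_trans (ler_normB _ _) _; apply: lerD => //.
have iDx : (haar R 1).-integrable setT (EFin \o (fun a : 1.-tuple R => H a * complex.Im (xi a x) -
    kappa * conj_kernel x a)).
  by apply: haar_integrableB => //; exact: haar_integrableZ.
have -> : \int[haar R 1]_a (H a * complex.Im (xi a x)) =
    kappa * \int[haar R 1]_a conj_kernel x a +
    \int[haar R 1]_a (H a * complex.Im (xi a x) - kappa * conj_kernel x a).
  rewrite RintegralB//; last exact: haar_integrableZ.
  by rewrite RintegralZl// addrC subrK.
apply: le_trans (ler_normD _ _) _; apply: lerD.
  by rewrite normrM ler_piMr.
apply: Rintegral_bounded => //; first by have /measurable_int/measurable_EFinP := iDx.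
by move=> a ta a0; rewrite /H mulrAC; exact: hC.
Qed.

End BoundedCharacters.

(** * The Dirichlet form *)

Section SquaredModulus.
Variable R : realType.
Implicit Types z w : R[i].

(** Valued in [R], unlike [|z|], which lives in [R[i]]; real inequalities then apply directly. *)
Definition sqmod z : R := complex.Re z ^+ 2 + complex.Im z ^+ 2.

Lemma sqmod_ge0 z : 0 <= sqmod z.
Proof. by rewrite addr_ge0// sqr_ge0. Qed.

Lemma sqmodM z w : sqmod (z * w) = sqmod z * sqmod w.
Proof. by rewrite /sqmod creM cimM; ring. Qed.

Lemma sqmodD_le z w : sqmod (z + w) <= 2 * sqmod z + 2 * sqmod w.
Proof.
rewrite /sqmod creD cimD.
have := sqr_ge0 (complex.Re z - complex.Re w).
by have := sqr_ge0 (complex.Im z - complex.Im w); nra.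
Qed.

Lemma sqmod_eq0 z : sqmod z = 0 -> z = 0.
Proof.
case: z => [a b]; rewrite /sqmod/= => h.
have [a0 b0] : a = 0 /\ b = 0 by have := sqr_ge0 a; have := sqr_ge0 b; split; nra.
by rewrite a0 b0.
Qed.

Lemma mulconj z : z * conjc z = (sqmod z)%:C.
Proof. by apply: complex_eqP; rewrite ?creM ?cimM; case: z => a b /=; rewrite /sqmod/=; ring. Qed.

Lemma sqmod_sum_le I (r : seq I) (F : I -> R[i]) :
  sqmod (\sum_(i <- r) F i) <= (size r)%:R * \sum_(i <- r) sqmod (F i).
Proof.
elim: r => [|i r IH]; first by rewrite !big_nil mulr0 /sqmod/= !expr0n/= addr0.
rewrite !big_cons /= -natr1.
set S := \sum_(j <- r) F j in IH *; set T := \sum_(j <- r) sqmod (F j) in IH *.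
have T0 : 0 <= T by apply: sumr_ge0 => j _; exact: sqmod_ge0.
have [r0|rn0] := eqVneq (size r) 0%N.
  by rewrite /S /T (size0nil r0) !big_nil !addr0 add0r mul1r.
have n0 : 0 < (size r)%:R :> R by rewrite ltr0n lt0n.
set n : R := (size r)%:R in n0 IH *.
set c := complex.Re (F i) * complex.Re S + complex.Im (F i) * complex.Im S.
(* The weight [n] in Young's inequality is chosen so that the leftover [sqmod S / n] is absorbed by
   the induction hypothesis. *)
have cross : 2 * c <= n * sqmod (F i) + T.
  rewrite -(ler_pM2l n0); apply: (@le_trans _ _ (n ^+ 2 * sqmod (F i) + sqmod S)).
    rewrite /c /sqmod; have := sqr_ge0 (n * complex.Re (F i) - complex.Re S).
    by have := sqr_ge0 (n * complex.Im (F i) - complex.Im S); nra.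
  by move: IH; clear; nra.
rewrite [sqmod (_ + _)](_ : _ = sqmod (F i) + sqmod S + 2 * c); last first.
  by rewrite /sqmod /c creD cimD; ring.
move: cross IH; clear; nra.
Qed.

Lemma sqmod_expi2pi (t : R) : sqmod (expi2pi t) = 1.
Proof. exact: cos2Dsin2. Qed.

End SquaredModulus.

Section Energy.
Variables (R : realType) (d k D : nat) (G : periodic_graph d k).
Hypothesis Greg : regular_graph G D.
Local Notation C := R[i].

(** By periodicity the edges leaving the cell of 0 determine all others, and they have finitely many
    displacements. Closing the set under negation lets incoming edges be counted by reflecting
    outgoing ones. *)
Lemma finite_range : exists X : seq 'rV[int]_d,
  [/\ uniq X, (forall x, x \in X -> - x \in X)
    & forall x l j, G (0, l) (x, j) != 0%N -> x \in X].
Proof.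
have hs (l : 'I_k) : exists s : seq 'rV[int]_d,
    forall x j, G (0, l) (x, j) != 0%N -> x \in s.
  have /finite_seqP[s hs] := (Greg (0, l)).1; exists (map fst s) => x j hx.
  have : [set q | G (0, l) q <> 0%N] (x, j) by apply/eqP.
  by rewrite hs /= => /(map_f fst).
have [S hS] := choice hs.
pose X0 := flatten [seq S l | l <- enum 'I_k].
exists (undup (X0 ++ map -%R X0)); split.
- exact: undup_uniq.
- move=> x; rewrite !mem_undup !mem_cat => /orP[xX|/mapP[y yX ->]].
    by rewrite map_f// orbT.
  by rewrite opprK yX.
- move=> x l j /hS xS; rewrite mem_undup mem_cat; apply/orP; left.
  by apply/flattenP; exists (S l) => //; apply: map_f; rewrite mem_enum.
Qed.

Variable X : seq 'rV[int]_d.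
Hypotheses (uniqX : uniq X) (oppX : forall x, x \in X -> - x \in X).
Hypothesis suppX : forall x l j, G (0, l) (x, j) != 0%N -> x \in X.

Lemma mult_translate y z l j : G (y, l) (z, j) = G (0, l) (z - y, j).
Proof.
by rewrite -(mult_shift G (- y) (y, l) (z, j)) /Defs.shift/= subrr.
Qed.

Lemma mult_opp x l j : G (0, l) (x, j) = G (0, j) (- x, l).
Proof. by rewrite mult_sym mult_translate sub0r. Qed.

Lemma big_neighbors (T : Type) (idx : T) (op : Monoid.com_law idx)
    (F : vertex d k -> T) (y : 'rV[int]_d) (l : 'I_k) :
  (forall q, G (y, l) q = 0%N -> F q = idx) ->
  \big[op/idx]_(q \in [set: vertex d k]) F q =
  \big[op/idx]_(x <- X) \big[op/idx]_(j < k) F (y + x, j).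
Proof.
move=> F0; pose s := [seq (y + x, j) | x <- X, j <- enum 'I_k].
rewrite (fsbigE s)//.
- rewrite (eq_bigl xpredT); last by move=> q; rewrite in_setT.
  rewrite big_allpairs_dep/=; apply: eq_bigr => x _.
  by rewrite big_enum.
- apply: allpairs_uniq => //; first exact: enum_uniq.
  by move=> [x1 j1] [x2 j2] _ _ /= [/addrI -> ->].
- move=> [z j] _ zs; apply: F0; apply/eqP; apply: contraNT zs => Gz.
  apply/allpairsP; exists (z - y, j) => /=; rewrite mem_enum; split=> //.
  + by apply: (suppX (l := l) (j := j)); rewrite -mult_translate.
  + by rewrite subrKC.
Qed.

Lemma out_degree l : (\sum_(x <- X) \sum_(j < k) G (0%R, l) (x, j) = D)%N.
Proof.
have [_ <-] := Greg (0, l); rewrite (@big_neighbors _ _ _ _ 0 l)//.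
by apply: eq_bigr => x _; apply: eq_bigr => j _; rewrite add0r.
Qed.

Lemma in_degree j : (\sum_(x <- X) \sum_(l < k) G (0%R, l) (x, j) = D)%N.
Proof.
rewrite -(out_degree j).
transitivity (\sum_(x <- map -%R X) \sum_(l < k) G (0%R, j) (x, l))%N.
  rewrite big_map; apply: eq_bigr => x _; apply: eq_bigr => l _.
  by rewrite mult_opp.
apply: perm_big; apply: uniq_perm => //; first by rewrite map_inj_uniq//; exact: oppr_inj.
move=> x; apply/mapP/idP => [[y yX ->]|xX]; first exact: oppX.
by exists (- x); rewrite ?opprK//; exact: oppX.
Qed.

Lemma walk_opE (f : vertex d k -> C) y l : walk_op G D f (y, l) =
  D%:R^-1 * \sum_(x <- X) \sum_(j < k) (G (0, l) (x, j))%:R * f (y + x, j).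
Proof.
rewrite /walk_op; congr (_ * _).
rewrite (@big_neighbors _ _ _ (fun q => (G (y, l) q)%:R * f q) y l) => [|q ->]; last by rewrite mul0r.
by apply: eq_bigr => x _; apply: eq_bigr => j _; rewrite mult_translate addrC addKr.
Qed.

Lemma QE a l j : Q G D a l j =
  D%:R^-1 * \sum_(x <- X) xi a x * (G (0, l) (x, j))%:R :> C.
Proof.
rewrite /Q (fsbigE X) ?mxE//; last first.
  move=> x _ xX; apply/matrixP => l' j'; rewrite !mxE.
  have [->|/suppX xX'] := eqVneq (G (0, l') (x, j')) 0%N; first by rewrite mulr0.
  by rewrite xX' in xX.
congr (_ * _); rewrite (eq_bigl xpredT); last by move=> q; rewrite in_setT.
by rewrite summxE; apply: eq_bigr => x _; rewrite !mxE.
Qed.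

Definition energy (a : d.-tuple R) (f : 'cV[C]_k) : R :=
  \sum_(x <- X) \sum_(l < k) \sum_(j < k)
    (G (0, l) (x, j))%:R * sqmod (f l 0 - xi a x * f j 0).

(** On expanding the squares, [xi] has modulus 1, so the diagonal terms count out-degrees and
    in-degrees, each giving [D] times the squared norm of [f]; the cross terms assemble into [Q]. *)
Lemma energyE a f : (0 < D)%N ->
  energy a f = 2 * D%:R * complex.Re (inner ((1%:M - Q G D a) *m f) f).
Proof.
move=> D0; have Dn0 : D%:R != 0 :> R by rewrite pnatr_eq0 -lt0n.
have sqB (x : 'rV[int]_d) (z w : C) : sqmod (z - xi a x * w) =
    sqmod z + sqmod w - 2 * complex.Re (xi a x * w * conjc z).
  have := sqmod_expi2pi (dot a x); rewrite -/(xi a x).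
  case: (xi a x) z w => [p q] [z1 z2] [w1 w2]; rewrite /sqmod/= => h.
  rewrite (_ : w1 ^+ 2 + w2 ^+ 2 = (p ^+ 2 + q ^+ 2) * (w1 ^+ 2 + w2 ^+ 2)); last by rewrite h mul1r.
  ring.
have -> : energy a f = D%:R * (\sum_(l < k) sqmod (f l 0)) +
    D%:R * (\sum_(j < k) sqmod (f j 0)) -
    2 * complex.Re (\sum_(x <- X) \sum_(l < k) \sum_(j < k)
      (G (0, l) (x, j))%:R * (xi a x * f j 0 * conjc (f l 0))).
  rewrite /energy.
  under eq_bigr => x _ do under eq_bigr => l _ do under eq_bigr => j _ do
    rewrite sqB mulrBr mulrDr.
  under eq_bigr => x _ do under eq_bigr => l _ do rewrite big_split/= big_split/=.
  under eq_bigr => x _ do rewrite big_split/= big_split/=.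
  rewrite big_split/= big_split/=; congr (_ + _ + _).
  - rewrite exchange_big/= mulr_sumr; apply: eq_bigr => l _.
    rewrite -(out_degree l) natr_sum mulr_suml; apply: eq_bigr => x _.
    by rewrite natr_sum mulr_suml.
  - under eq_bigr => x _ do rewrite exchange_big/=.
    rewrite exchange_big/= mulr_sumr; apply: eq_bigr => j _.
    rewrite -(in_degree j) natr_sum mulr_suml; apply: eq_bigr => x _.
    by rewrite natr_sum mulr_suml.
  - rewrite cre_sum mulr_sumr -sumrN; apply: eq_bigr => x _.
    rewrite cre_sum mulr_sumr -sumrN; apply: eq_bigr => l _.
    rewrite cre_sum mulr_sumr -sumrN; apply: eq_bigr => j _.
    rewrite [X in _ = - (2 * X)](_ : _ = (G (0, l) (x, j))%:R * complex.Re (xi a x * f j 0 * conjc (f l 0))); last first.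
      by rewrite -(rmorph_nat (real_complex R)) cre_realM.
    by rewrite mulrCA.
have -> : inner ((1%:M - Q G D a) *m f) f = (\sum_(l < k) sqmod (f l 0))%:C -
    D%:R^-1 * (\sum_(x <- X) \sum_(l < k) \sum_(j < k)
      (G (0, l) (x, j))%:R * (xi a x * f j 0 * conjc (f l 0))).
  rewrite /inner mulmxBl mul1mx.
  under eq_bigr => l _ do
    rewrite [(f - _) l 0]mxE [(- (Q G D a *m f)) l 0]mxE
      [(Q G D a *m f) l 0]mxE mulrBl mulconj.
  rewrite sumrB rmorph_sum/=; congr (_ - _).
  rewrite exchange_big/= mulr_sumr; apply: eq_bigr => l _.
  rewrite mulr_suml.
  under [LHS]eq_bigr => j _ do rewrite QE -!mulrA mulr_suml.
  rewrite -mulr_sumr exchange_big/=; congr (_ * _); apply: eq_bigr => x _.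
  by apply: eq_bigr => j _; ring.
rewrite creD creN /= -(rmorph_nat (real_complex R)) -fmorphV cre_realM.
by field.
Qed.

(** The Bloch wave of quasi-momentum [a] with profile [f]; [energy] is its Dirichlet energy per
    cell. *)
Definition lift_fun (a : d.-tuple R) (f : 'cV[C]_k) (p : vertex d k) : C :=
  xi a p.1 * f p.2 0.

Lemma energy_ge0 a f : 0 <= energy a f.
Proof.
apply: sumr_ge0 => x _; apply: sumr_ge0 => l _; apply: sumr_ge0 => j _.
by rewrite mulr_ge0// sqmod_ge0.
Qed.

(** Translating the edge to the cell of 0 multiplies the difference by a number of modulus 1 and
    leaves one of the nonnegative summands of [energy]. *)
Lemma edge_energy a f p q : (0 < G p q)%N ->
  sqmod (lift_fun a f p - lift_fun a f q) <= energy a f.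
Proof.
case: p q => [y l] [z j] Gpq; rewrite /lift_fun/=.
rewrite mult_translate in Gpq.
have zX : z - y \in X by apply: (suppX (l := l) (j := j)); rewrite -lt0n.
have -> : xi a y * f l 0 - xi a z * f j 0 =
    xi a y * (f l 0 - xi a (z - y) * f j 0).
  by rewrite mulrBr mulrA -xiD subrKC.
rewrite sqmodM sqmod_expi2pi mul1r /energy (bigD1_seq (z - y))//=.
rewrite (bigD1 l)//= (bigD1 j)//= -!addrA.
apply: (@le_trans _ _ ((G (0, l) (z - y, j))%:R * sqmod (f l 0 - xi a (z - y) * f j 0))).
  by rewrite ler_peMl ?sqmod_ge0// ler1n.
rewrite lerDl !addr_ge0//; do ?[apply: sumr_ge0 => ? _]; by rewrite mulr_ge0// sqmod_ge0.
Qed.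

Lemma path_energy p (s : seq (vertex d k)) :
  path (fun a b => (0 < G a b)%N) p s ->
  exists2 K : R, 0 <= K & forall a f,
  sqmod (lift_fun a f p - lift_fun a f (last p s)) <= K * energy a f.
Proof.
elim: s p => [|q s IH] p /=.
  by move=> _; exists 0 => // a f; rewrite subrr mul0r /sqmod/= !expr0n addr0.
move=> /andP[pq /IH[K K0 hK]]; exists (2 + 2 * K); first lra.
move=> a f; rewrite -(subrK (lift_fun a f q) (lift_fun a f p)) -addrA.
apply: le_trans (sqmodD_le _ _) _.
rewrite (_ : _ * energy a f = 2 * energy a f + 2 * (K * energy a f)); last by ring.
by apply: lerD; apply: ler_wpM2l => //; exact: edge_energy.
Qed.

Hypothesis Gconn : connected_graph G.

(** A path from [(0, l)] to [(0, j)] controls [f_l - f_j]; one from [(0, l)] to [(e_i, l)] controls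
    the phase gained over one period, times [f_l]. Paths are chosen before [a] and [f], and finitely
    many are used, so summing their constants gives a uniform [K]. *)
Lemma poincare : exists2 K : R, 0 < K & forall a (f : 'cV[C]_k),
  (forall l j : 'I_k, sqmod (f l 0 - f j 0) <= K * energy a f) /\
  (forall (l : 'I_k) (i : 'I_d),
     sqmod (1 - expi2pi (tnth a i)) * sqmod (f l 0) <= K * energy a f).
Proof.
have hpath p q : exists K : R, 0 <= K /\ forall a f,
    sqmod (lift_fun a f p - lift_fun a f q) <= K * energy a f.
  by have [s ps <-] := Gconn p q; have [K K0 hK] := path_energy ps; exists K.
have [K hK] := choice (fun pq => hpath pq.1 pq.2).
pose K1 := \sum_(l < k) \sum_(j < k) K ((0, l), (0, j)).
pose K2 := \sum_(l < k) \sum_(i < d) K ((0, l), (unit_vec i, l)).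
have K10 : 0 <= K1 by apply: sumr_ge0 => l _; apply: sumr_ge0 => j _; exact: (hK _).1.
have K20 : 0 <= K2 by apply: sumr_ge0 => l _; apply: sumr_ge0 => j _; exact: (hK _).1.
exists (K1 + K2 + 1); first lra.
move=> a f; have E0 := energy_ge0 a f; split.
- move=> l j; have := (hK ((0, l), (0, j))).2 a f; rewrite /lift_fun/= xi0 !mul1r.
  move/le_trans; apply; apply: ler_wpM2r => //.
  have : K ((0, l), (0, j)) <= K1; last lra.
  rewrite /K1 (bigD1 l)//= (bigD1 j)//= -addrA lerDl addr_ge0//.
    by apply: sumr_ge0 => ? _; exact: (hK _).1.
  by apply: sumr_ge0 => ? _; apply: sumr_ge0 => ? _; exact: (hK _).1.
- move=> l i; have := (hK ((0, l), (unit_vec i, l))).2 a f.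
  rewrite /lift_fun/= xi0 /xi dot_unit -mulrBl sqmodM.
  move/le_trans; apply; apply: ler_wpM2r => //.
  have : K ((0, l), (unit_vec i, l)) <= K2; last lra.
  rewrite /K2 (bigD1 l)//= (bigD1 i)//= -addrA lerDl addr_ge0//.
    by apply: sumr_ge0 => ? _; exact: (hK _).1.
  by apply: sumr_ge0 => ? _; apply: sumr_ge0 => ? _; exact: (hK _).1.
Qed.

End Energy.

(** * The spectrum of Q *)

Section RealTrigMatrix.
Variables (R : realType) (d : nat).

Lemma realtrig_det n (M : d.-tuple R -> 'M[R[i]]_n) :
  (forall i j, realtrig (fun a => M a i j)) -> realtrig (fun a => \det (M a)).
Proof.
move=> h; rewrite /determinant; apply: realtrig_sum => s _.
apply: realtrigM; last by apply: realtrig_prod => i _; exact: h.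
by have := @realtrig_cst R d ((-1) ^+ perm.odd_perm s);
  apply: realtrig_ext => a; rewrite rmorphXn/= rmorphN1.
Qed.

Lemma realtrig_adj n (M : d.-tuple R -> 'M[R[i]]_n) i j :
  (forall i j, realtrig (fun a => M a i j)) -> realtrig (fun a => (\adj (M a)) i j).
Proof.
move=> h; apply: (@realtrig_ext _ _ (fun a => (-1) ^+ (j + i) *
    \det (row' j (col' i (M a))))).
  by move=> a; rewrite mxE.
apply: realtrigM.
  by have := @realtrig_cst R d ((-1) ^+ (j + i));
    apply: realtrig_ext => a; rewrite rmorphXn/= rmorphN1.
apply: realtrig_det => i' j'; have := h (lift j i') (lift i j'); apply: realtrig_ext => a.
by rewrite !mxE.
Qed.

End RealTrigMatrix.

Section Spectrum.
Variables (R : realType) (d k D : nat) (G : periodic_graph d k).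
Hypothesis Greg : regular_graph G D.
Hypothesis Gconn : connected_graph G.
Hypothesis D0 : (0 < D)%N.
Local Notation C := R[i].

Lemma innerDl (u1 u2 w : 'cV[C]_k) : inner (u1 + u2) w = inner u1 w + inner u2 w.
Proof.
by rewrite /inner -big_split/=; apply: eq_bigr => l _; rewrite mxE mulrDl.
Qed.

Lemma innerDr (u1 u2 w : 'cV[C]_k) : inner w (u1 + u2) = inner w u1 + inner w u2.
Proof.
rewrite /inner -big_split/=; apply: eq_bigr => l _.
by rewrite mxE (rmorphD conjc) mulrDr.
Qed.

Lemma innerZl (c : C) (u w : 'cV[C]_k) : inner (c *: u) w = c * inner u w.
Proof.
by rewrite /inner mulr_sumr; apply: eq_bigr => l _; rewrite mxE mulrA.
Qed.

Lemma innerZr (c : C) (u w : 'cV[C]_k) : inner w (c *: u) = conjc c * inner w u.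
Proof.
rewrite /inner mulr_sumr; apply: eq_bigr => l _.
by rewrite mxE (rmorphM conjc) mulrCA.
Qed.

Lemma inner_self (w : 'cV[C]_k) : inner w w = (\sum_(l < k) sqmod (w l 0))%:C.
Proof. by rewrite rmorph_sum/=; apply: eq_bigr => l _; rewrite mulconj. Qed.

Section Eigenpair.
Variables (a : d.-tuple R) (v : 'I_k -> 'cV[C]_k) (lam : 'I_k -> R).
Hypothesis orthov : forall m n, inner (v m) (v n) = (m == n)%:R.
Hypothesis eigv : forall m, Q G D a *m v m = (lam m)%:C *: v m.

Lemma one_minus_Q_eig m : (1%:M - Q G D a) *m v m = (1 - (lam m)%:C) *: v m.
Proof. by rewrite mulmxBl mul1mx eigv scalerBl scale1r. Qed.

Let V := \matrix_(l < k, m < k) v m l 0.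
Let Vadj := \matrix_(m < k, l < k) conjc (v m l 0).

Let VadjV : Vadj *m V = 1%:M.
Proof.
apply/matrixP => m n; rewrite !mxE.
rewrite eq_sym -orthov /inner; apply: eq_bigr => l _.
by rewrite !mxE mulrC.
Qed.

Let VVadj : V *m Vadj = 1%:M.
Proof. exact: mulmx1C VadjV. Qed.

Lemma eigenbasis_expansion (u : 'cV[C]_k) : \sum_(m < k) inner u (v m) *: v m = u.
Proof.
rewrite -[RHS]mul1mx -VVadj -mulmxA; apply/matrixP => l j.
rewrite (ord1 j) summxE [RHS]mxE; apply: eq_bigr => m _.
rewrite [LHS]mxE mulrC [V l m]mxE [X in _ = _ * X]mxE; congr (_ * _).
by rewrite /inner; apply: eq_bigr => l' _; rewrite [Vadj m l']mxE mulrC.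
Qed.

Lemma det_one_minus_Q :
  \det (1%:M - Q G D a) = (\prod_(m < k) (1 - lam m))%:C.
Proof.
have dV : \det V != 0.
  apply/negP => /eqP h; have := congr1 determinant VadjV.
  by rewrite det_mulmx h mulr0 det1 => /eqP; rewrite eq_sym oner_eq0.
apply: (mulIf dV); rewrite -det_mulmx.
have -> : (1%:M - Q G D a) *m V = V *m diag_mx (\row_m (1 - (lam m)%:C)).
  apply/matrixP => l m; rewrite mul_mx_diag !mxE.
  have /matrixP/(_ l 0) := one_minus_Q_eig m.
  rewrite [RHS]mxE mulrC => <-.
  by rewrite mxE; apply: eq_bigr => j _; rewrite [V j m]mxE.
rewrite det_mulmx det_diag mulrC rmorph_prod; congr (_ * _).
by apply: eq_bigr => m _; rewrite mxE rmorphB.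
Qed.

(** The spectral sum [F] solves [(I - Q) F = u]; applying the adjugate leaves an expression
    polynomial in the entries of [Q], in which no eigenvector appears. *)
Lemma resolvent_cramer (u : 'cV[C]_k) l : (forall m, lam m != 1) ->
  \det (1%:M - Q G D a) *
    (\sum_(m < k) (inner u (v m) * (1 - (lam m)%:C)^-1) *: v m) l 0 =
  (\adj (1%:M - Q G D a) *m u) l 0.
Proof.
move=> lam1; set F := \sum_(m < k) _.
have HF : (1%:M - Q G D a) *m F = u.
  rewrite -[RHS]eigenbasis_expansion mulmx_sumr; apply: eq_bigr => m _.
  rewrite -scalemxAr one_minus_Q_eig scalerA -mulrA mulVf ?mulr1//.
  by rewrite -(rmorph1 (real_complex R)) -rmorphB/= (inj_eq (@complexI R)) subr_eq0 eq_sym.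
by rewrite -[in RHS]HF mulmxA mul_adj_mx mul_scalar_mx [RHS]mxE.
Qed.

End Eigenpair.

(* Poincare: [1 - lam m >= c |a|^2] for every [m], and two eigenvalues cannot
   both be close to 1, since some combination of their eigenvectors has zero sum. *)
Lemma eigenvalue_gap : exists2 c : R, 0 < c & forall (a : d.-tuple R)
    (v : 'I_k -> 'cV[C]_k) (lam : 'I_k -> R), @torus R d a ->
  (forall m n, inner (v m) (v n) = (m == n)%:R) ->
  (forall m, Q G D a *m v m = (lam m)%:C *: v m) ->
  (forall m, c * supn a ^+ 2 <= 1 - lam m) /\
  (forall m n, m != n -> c <= Num.max (1 - lam m) (1 - lam n)).
Proof.
have [X [uniqX oppX suppX]] := finite_range Greg.
have [K K0 hK] := poincare R uniqX suppX Gconn.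
have Dp : 0 < D%:R :> R by rewrite ltr0n.
have [k0|kpos] := posnP k.
  exists 1 => // a v lam _ _ _.
  by split=> m; exfalso; case: m => m; rewrite k0.
have kp : 0 < k%:R :> R by rewrite ltr0n.
(* [2 * D] converts the energy into [1 - lam], [K] is the constant of [poincare], and [k] comes from
   summing over the coordinates of a vector. *)
pose B : R := 2 * D%:R * (k%:R * K).
have B0 : 0 < B by rewrite !mulr_gt0.
exists B^-1; first by rewrite invr_gt0.
move=> a v lam ta orthov eigv.
have energyQ f : energy G X a f = 2 * D%:R * complex.Re (inner ((1%:M - Q G D a) *m f) f).
  exact: energyE.
have norm1 m : \sum_(l < k) sqmod (v m l 0) = 1.
  by have := orthov m m; rewrite inner_self eqxx => /(congr1 (@complex.Re R)).
have en m : energy G X a (v m) = 2 * D%:R * (1 - lam m).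
  rewrite energyQ (one_minus_Q_eig eigv) innerZl orthov eqxx mulr1.
  by rewrite creD creN.
have lam_le m : 0 <= 1 - lam m.
  rewrite -(pmulr_rge0 _ (_ : 0 < 2 * D%:R)) -?en ?energy_ge0//.
  by rewrite mulr_gt0.
split=> [m|m n mn].
- rewrite mulrC ler_pdivrMr//.
  have hi i : tnth a i ^+ 2 <= (1 - lam m) * B.
    have h1 : sqmod (1 - expi2pi (tnth a i)) <= k%:R * (K * energy G X a (v m)).
      rewrite -[leLHS]mulr1 -[X in _ * X <= _](norm1 m) mulr_sumr.
      apply: (@le_trans _ _ (\sum_(l < k) K * energy G X a (v m))).
        by apply: ler_sum => l _; exact: (hK a (v m)).2.
      by rewrite sumr_const card_ord mulr_natl.
    have /andP[t1 t2] := ta i.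
    have := @one_minus_cos_ge R (tnth a i); rewrite ler_norml t2 ltW// => /(_ isT).
    have : sqmod (1 - expi2pi (tnth a i)) = 2 * (1 - cos (2 * pi * tnth a i)).
      rewrite /sqmod creD cimD creN cimN /= add0r sqrrN sin2cos2; ring.
    rewrite en in h1; rewrite /B.
    set z := 1 - cos _; set t2' := tnth a i ^+ 2 => h2 h3.
    have t0 : 0 <= t2' by exact: sqr_ge0.
    have -> : (1 - lam m) * (2 * D%:R * (k%:R * K)) = k%:R * (K * (2 * D%:R * (1 - lam m))) by ring.
    by apply: le_trans h1; rewrite h2; lra.
  have BB : 0 <= (1 - lam m) * B by rewrite mulr_ge0// ltW.
  rewrite -(sqr_sqrtr BB); apply: lerXn2r; rewrite ?nnegrE ?supn_ge0 ?sqrtr_ge0//.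
  by apply/supn_le => [|i]; rewrite ?sqrtr_ge0// -sqrtr_sqr ler_wsqrtr.
- pose sm := \sum_(l < k) v m l 0; pose sn := \sum_(l < k) v n l 0.
  have omm : inner (v m) (v m) = 1 by rewrite orthov eqxx.
  have onn : inner (v n) (v n) = 1 by rewrite orthov eqxx.
  have omn : inner (v m) (v n) = 0 by rewrite orthov (negbTE mn).
  have onm : inner (v n) (v m) = 0 by rewrite orthov eq_sym (negbTE mn).
  have key (al be : C) : al * sm + be * sn = 0 ->
      sqmod al + sqmod be <= B * (sqmod al * (1 - lam m) + sqmod be * (1 - lam n)).
    move=> h0; pose f := al *: v m + be *: v n.
    have sumf : \sum_(l < k) f l 0 = 0.
      apply: etrans h0; rewrite /sm /sn !mulr_sumr -big_split/=; apply: eq_bigr => l _.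
      by rewrite !mxE.
    have nf : \sum_(l < k) sqmod (f l 0) = sqmod al + sqmod be.
      have := inner_self f; rewrite /f innerDl 2!innerDr 4!innerZl 4!innerZr omm omn onm onn.
      rewrite !mulr0 !mulr1 addr0 add0r !mulconj.
      by move/(congr1 (@complex.Re R)) => /= <-.
    have ef : energy G X a f = 2 * D%:R * (sqmod al * (1 - lam m) + sqmod be * (1 - lam n)).
      rewrite energyQ; congr (_ * _); rewrite /f mulmxDr -!scalemxAr !(one_minus_Q_eig eigv).
      rewrite !scalerA.
      rewrite innerDl 2!innerDr 4!innerZl 4!innerZr omm omn onm onn.
      rewrite !mulr0 !mulr1 addr0 add0r -!mulrA.
      have scale (z : C) (r : R) : z * ((1 - r%:C) * conjc z) = (sqmod z * (1 - r))%:C.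
        by rewrite mulrCA mulconj mulrC rmorphM rmorphB rmorph1.
      by rewrite !scale creD.
    rewrite -nf (_ : B * _ = k%:R * (K * energy G X a f)); last by rewrite ef /B; ring.
    (* As the coordinates of [f] sum to 0, [k f_l] is the sum of the [f_l - f_j]: the oscillation of
       [f], and hence its energy, controls [f] itself. *)
    have fl l : sqmod (f l 0) <= K * energy G X a f.
      have : sqmod (k%:R * f l 0) <= k%:R * (k%:R * (K * energy G X a f)).
        have -> : k%:R * f l 0 = \sum_(j <- enum 'I_k) (f l 0 - f j 0).
          by rewrite big_enum/= sumrB sumf subr0 sumr_const card_ord mulr_natl.
        apply: le_trans (sqmod_sum_le _ _) _; rewrite size_enum_ord.
        apply: ler_wpM2l => //; rewrite big_enum/=.
        apply: (@le_trans _ _ (\sum_(j < k) K * energy G X a f)).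
          by apply: ler_sum => j _; exact: (hK a f).1.
        by rewrite sumr_const card_ord mulr_natl.
      rewrite sqmodM -(rmorph_nat (real_complex R)) {1}/sqmod/= expr0n addr0 expr2 -mulrA.
      by rewrite !ler_pM2l.
    apply: (@le_trans _ _ (\sum_(l < k) K * energy G X a f)).
      by apply: ler_sum => l _; exact: fl.
    by rewrite sumr_const card_ord mulr_natl.
  have concl (p q : R) : 0 <= p -> 0 <= q -> 0 < p + q ->
      p + q <= B * (p * (1 - lam m) + q * (1 - lam n)) ->
      B^-1 <= Num.max (1 - lam m) (1 - lam n).
    move=> p0 q0 pq; set M := Num.max _ _ => h.
    have h1 : 1 - lam m <= M by rewrite le_max lexx.
    have h2 : 1 - lam n <= M by rewrite le_max lexx orbT.
    rewrite -[B^-1]mul1r ler_pdivrMr// -(ler_pM2l pq) mulr1.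
    apply: le_trans h _.
    rewrite (_ : (p + q) * (M * B) = B * (p * M + q * M)); last by ring.
    by apply: ler_wpM2l; [exact: ltW|apply: lerD; exact: ler_wpM2l].
  (* The combination [sn v_m - sm v_n] has zero sum, but is trivial if both sums vanish; then [v m]
     itself has zero sum and serves instead. *)
  have [s0|s0] := eqVneq (sqmod sn + sqmod sm) 0.
    have sm0 : sm = 0.
      by apply: sqmod_eq0; have := sqmod_ge0 sm; have := sqmod_ge0 sn; lra.
    have := key 1 0; rewrite sm0 mulr0 mul0r addr0 => /(_ erefl).
    by apply: concl; rewrite ?sqmod_ge0// /sqmod/= !expr0n/= expr1n; lra.
  have := key sn (- sm); rewrite mulrC mulNr addrN => /(_ erefl).
  have -> : sqmod (- sm) = sqmod sm by rewrite /sqmod creN cimN !sqrrN.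
  by apply: concl; rewrite ?sqmod_ge0// lt_neqAle eq_sym s0 addr_ge0// sqmod_ge0.
Qed.

End Spectrum.

(** * The determinant of I - Q *)

Section Symbol.
Variables (R : realType) (d k D : nat) (G : periodic_graph d k).
Hypothesis d0 : (0 < d)%N.
Hypothesis k0 : (0 < k)%N.
Hypothesis Greg : regular_graph G D.
Hypothesis Gconn : connected_graph G.
Hypothesis D0 : (0 < D)%N.
Local Notation C := R[i].
Variables (v : d.-tuple R -> 'I_k -> 'cV[C]_k) (lam : d.-tuple R -> 'I_k -> R).
Hypothesis orthov : forall a, @torus R d a -> forall m n, inner (v a m) (v a n) = (m == n)%:R.
Hypothesis eigv : forall a, @torus R d a -> forall m, Q G D a *m v a m = (lam a m)%:C *: v a m.

Definition symbol (a : d.-tuple R) : 'M[C]_k := 1%:M - Q G D a.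
Definition detsym (a : d.-tuple R) : C := \det (symbol a).

Lemma realtrig_symbol l j : realtrig (fun a => symbol a l j).
Proof.
have [X [uniqX oppX suppX]] := finite_range Greg.
have -> : (fun a => symbol a l j) = fun a => (l == j)%:R + - (D%:R^-1 * (\sum_(x <- X) xi a x * (G (0, l) (x, j))%:R)).
  by apply/funext => a; rewrite -(QE D uniqX suppX) /symbol [LHS]mxE [X in X + _]mxE [X in _ + X]mxE.
apply: realtrigD.
  by have := @realtrig_cst R d (l == j)%:R; apply: realtrig_ext => a; rewrite rmorph_nat.
apply: realtrigN; apply: realtrigM.
  have := @realtrig_cst R d (D%:R^-1); apply: realtrig_ext => a.
  by rewrite fmorphV rmorph_nat.
apply: realtrig_sum => x _; apply: realtrigM; first exact: realtrig_xi.
by have := @realtrig_cst R d (G (0, l) (x, j))%:R; apply: realtrig_ext => a; rewrite rmorph_nat.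
Qed.

Lemma realtrig_detsym : realtrig detsym.
Proof. by apply: realtrig_det => i j; exact: realtrig_symbol. Qed.

Lemma detsym_real a : @torus R d a -> detsym a = (complex.Re (detsym a))%:C.
Proof. by move=> ta; rewrite /detsym (det_one_minus_Q (orthov ta) (eigv ta)). Qed.

(** The determinant is the product of the [1 - lam]. The smallest factor is bounded below by
    [c * supn a ^+ 2]; any other one is the larger of itself and the smallest, so the gap between
    eigenvalues makes it at least [c]. *)
Lemma detsym_lower : exists2 c : R, 0 < c & forall a, @torus R d a ->
  c * supn a ^+ 2 <= complex.Re (detsym a).
Proof.
have [c c0 hc] := eigenvalue_gap R Greg Gconn D0.
exists (c * c ^+ k.-1); first by rewrite mulr_gt0// exprn_gt0.
move=> a ta; have [h1 h2] := hc a _ _ ta (orthov ta) (eigv ta).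
rewrite /detsym (det_one_minus_Q (orthov ta) (eigv ta)) /=.
case: (@Order.TotalTheory.arg_minP _ R _ (Ordinal k0) xpredT (fun m => 1 - lam a m) isT) => m0 _ hm0.
rewrite (bigD1 m0)//= mulrAC; apply: ler_pM.
- by rewrite mulr_ge0 ?(ltW c0)// sqr_ge0.
- by rewrite exprn_ge0// ltW.
- exact: h1.
have <- : \prod_(m < k | m != m0) c = c ^+ k.-1.
  by rewrite prodr_const (eq_card (B := predC1 m0)) ?cardC1 ?card_ord.
apply: ler_prod => m mm0; rewrite (ltW c0)/=.
have := h2 _ _ mm0; rewrite le_max => /orP[//|] /le_trans; apply; exact: hm0.
Qed.

Lemma lam_neq1 a m : @torus R d a -> a <> origin R d -> lam a m != 1.
Proof.
move=> ta a0; have [c c0 hc] := eigenvalue_gap R Greg Gconn D0.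
have [h1 _] := hc a _ _ ta (orthov ta) (eigv ta).
have := h1 m; have := exprn_gt0 2 (supn_gt0 a0) => s0 h.
have : 0 < 1 - lam a m by apply: lt_le_trans h; rewrite mulr_gt0.
by rewrite subr_gt0 => /lt_eqF ->.
Qed.

Lemma symbol_origin_colsum j : \sum_(l < k) symbol (origin R d) l j = 0.
Proof.
have [X [uniqX oppX suppX]] := finite_range Greg.
have hl l : symbol (origin R d) l j =
    (l == j)%:R - D%:R^-1 * (\sum_(x <- X) (G (0, l) (x, j))%:R).
  rewrite /symbol [LHS]mxE [X in X + _]mxE [X in _ + X]mxE (QE D uniqX suppX).
  by congr (_ - _ * _); apply: eq_bigr => x _; rewrite xi_origin mul1r.
under eq_bigr => l _ do rewrite hl.
rewrite sumrB (bigD1 j)//= eqxx big1 ?addr0; last by move=> l /negbTE ->.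
rewrite -mulr_sumr exchange_big/=.
under eq_bigr => x _ do rewrite -natr_sum.
by rewrite -natr_sum (in_degree Greg uniqX oppX suppX) mulVf ?subrr// pnatr_eq0 -lt0n.
Qed.

Lemma detsym_origin : detsym (origin R d) = 0.
Proof.
apply/eqP/det0P; exists (const_mx 1).
  apply/negP => /eqP/matrixP/(_ 0 (Ordinal k0)); rewrite !mxE => /eqP.
  by rewrite oner_eq0.
apply/matrixP => i j; rewrite mxE [RHS]mxE -[RHS](symbol_origin_colsum j).
by apply: eq_bigr => l _; rewrite [const_mx 1 i l]mxE mul1r.
Qed.

(* The rows of [\adj (symbol 0)] are left null vectors of [symbol 0]; their
   conjugates have zero energy and are thus constant. *)
Lemma adj_symbol_origin (u : 'cV[C]_k) l : \sum_(j < k) u j 0 = 0 ->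
  (\adj (symbol (origin R d)) *m u) l 0 = 0.
Proof.
move=> u0; have [X [uniqX oppX suppX]] := finite_range Greg.
have [K K0 hK] := poincare R uniqX suppX Gconn.
set A := \adj _; pose f : 'cV[C]_k := \col_j conjc (A l j).
have Asym : A *m symbol (origin R d) = 0.
  by rewrite /A mul_adj_mx -/(detsym _) detsym_origin; apply/matrixP => i j; rewrite !mxE mul0rn.
have ef : energy G X (origin R d) f = 0.
  rewrite (energyE Greg uniqX oppX suppX)// -/(symbol _).
  rewrite (_ : inner _ _ = 0) ?mulr0// /inner.
  under eq_bigr => i _ do rewrite [(_ *m f) i 0]mxE [X in conjc X]mxE conjcK mulr_suml.
  rewrite exchange_big big1//= => j _.
  have /matrixP/(_ l j) := Asym; rewrite mxE [RHS]mxE => h.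
  apply: etrans (_ : f j 0 * (\sum_i A l i * symbol (origin R d) i j) = 0); last first.
    by rewrite h mulr0.
  rewrite mulr_sumr; apply: eq_bigr => i _; ring.
have Aconst j j' : A l j = A l j'.
  have := (hK (origin R d) f).1 j j'; rewrite ef mulr0 !mxE => h.
  apply: (can_inj (@conjcK R)); apply/eqP; rewrite -subr_eq0; apply/eqP.
  by apply: sqmod_eq0; apply/eqP; rewrite eq_le sqmod_ge0 h.
rewrite mxE; under eq_bigr => j _ do rewrite (Aconst j (Ordinal k0)).
by rewrite -mulr_sumr u0 mulr0.
Qed.

End Symbol.

(** * Bloch integrals *)

Section Quotients.
Variables (R : realType) (d : nat).
Hypothesis d0 : (0 < d)%N.
Variable g : d.-tuple R -> R[i].
Hypothesis tg : realtrig g.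
Variable c : R.
Hypothesis c0 : 0 < c.
Hypothesis gc : forall a, @torus R d a -> c * supn a ^+ 2 <= complex.Re (g a).
Local Notation haar_integrable h := ((haar R d).-integrable setT (EFin \o h)).

Let g_gt0 a : @torus R d a -> a <> origin R d -> 0 < complex.Re (g a).
Proof.
by move=> ta a0; apply: lt_le_trans (gc ta); rewrite mulr_gt0// exprn_gt0// supn_gt0.
Qed.

(** A numerator vanishing to order [n] leaves a pole of order [2 - n]. *)
Let quotient_le (h : R) (C : R) n a : @torus R d a -> a <> origin R d -> 0 <= C -> (n <= 2)%N ->
  `|h| <= C * supn a ^+ n -> `|h / complex.Re (g a)| * supn a ^+ (2 - n) <= C / c.
Proof.
move=> ta a0 C0 n2 hC; have gp := g_gt0 ta a0.
rewrite normrM normfV (gtr0_norm gp) mulrAC ler_pdivrMr// mulrAC ler_pdivlMr//.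
apply: (@le_trans _ _ (C * (c * supn a ^+ 2))); last first.
  by apply: ler_wpM2l => //; exact: gc.
apply: (@le_trans _ _ (C * supn a ^+ n * supn a ^+ (2 - n) * c)).
  apply: ler_wpM2r; first exact: ltW.
  by apply: ler_wpM2r => //; rewrite exprn_ge0// supn_ge0.
by rewrite -mulrA -mulrA [_ ^+ n * _]mulrA -exprD subnKC// [c * _]mulrC.
Qed.

Lemma integrable_Re_quotient f : realtrig f ->
  (3 <= d)%N \/ complex.Re (f (origin R d)) = 0 ->
  haar_integrable (fun a => complex.Re (f a) / complex.Re (g a)).
Proof.
move=> tf; have mq : measurable_fun setT (fun a => complex.Re (f a) / complex.Re (g a)).
  by apply: measurable_fun_div; exact: measurable_Re_realtrig.
case=> [d3|f0].
  have [C C0 hC] := realtrig_bounded tf.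
  apply: (@integrable_pole _ _ 2 (C / c)) => // a ta a0.
  by apply: (@quotient_le _ _ 0) => //; rewrite mulr1; exact: (hC a).1.
have [C C0 hC] := realtrig_near_origin tf.
apply: (@integrable_pole _ _ 0 (C / c)) => // a ta a0.
by apply: (@quotient_le _ _ 2) => //; have := (hC a).1; rewrite f0 subr0.
Qed.

Lemma integrable_Im_quotient f : realtrig f -> (2 <= d)%N ->
  haar_integrable (fun a => complex.Im (f a) / complex.Re (g a)).
Proof.
move=> tf d2; have mq : measurable_fun setT (fun a => complex.Im (f a) / complex.Re (g a)).
  by apply: measurable_fun_div; [exact: measurable_Im_realtrig|exact: measurable_Re_realtrig].
have [C C0 hC] := realtrig_near_origin tf.
apply: (@integrable_pole _ _ 1 (C / c)) => // a ta a0.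
by apply: (@quotient_le _ _ 1) => //; rewrite expr1; exact: (hC a).2.
Qed.

Variables f1 f2 : d.-tuple R -> R[i].
Hypotheses (tf1 : realtrig f1) (tf2 : realtrig f2).

(* [Re ((f1 + i f2) xi / g)], as [g] is real on the torus. *)
Definition mode_quotient (x : 'rV[int]_d) (a : d.-tuple R) : R :=
  (complex.Re (f1 a * xi a x) - complex.Im (f2 a * xi a x)) / complex.Re (g a).

Lemma mode_quotientE x : mode_quotient x = fun a =>
  complex.Re (f1 a * xi a x) / complex.Re (g a) - complex.Im (f2 a * xi a x) / complex.Re (g a).
Proof. by apply/funext => a; rewrite /mode_quotient mulrBl. Qed.

Lemma measurable_mode_quotient x : measurable_fun setT (mode_quotient x).
Proof.
have tx f : realtrig f -> realtrig (fun a => f a * xi a x).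
  by move=> tf; apply: realtrigM => //; exact: realtrig_xi.
apply: measurable_fun_div; last exact: measurable_Re_realtrig.
apply: measurable_funB; first by apply: measurable_Re_realtrig; exact: tx.
by apply: measurable_Im_realtrig; exact: tx.
Qed.

Lemma integrable_mode_quotient x :
  (3 <= d)%N \/ complex.Re (f1 (origin R d)) = 0 ->
  (2 <= d)%N \/ f2 = (fun=> 0) ->
  haar_integrable (mode_quotient x).
Proof.
move=> h1 h2; rewrite mode_quotientE; apply: haar_integrableB.
  apply: (integrable_Re_quotient (f := fun a => f1 a * xi a x)).
    by apply: realtrigM => //; exact: realtrig_xi.
  by case: h1 => [|h]; [left|right; rewrite xi_origin mulr1].
case: h2 => [d2|->].
  apply: (integrable_Im_quotient (f := fun a => f2 a * xi a x)) => //.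
  by apply: realtrigM => //; exact: realtrig_xi.
rewrite (_ : (fun a => _) = fun=> 0); first exact: integrable_haar_cst.
by apply/funext => a; rewrite mul0r /= mul0r.
Qed.

(* The measure is invariant under [a -> - a], for which the contribution of [f1]
   is even and that of [f2] is odd: the latter integrates to 0. *)
Lemma mode_quotient_bounded : complex.Re (g (origin R d)) = 0 ->
  (forall x, haar_integrable (mode_quotient x)) ->
  exists2 B, 0 <= B & forall x, `| \int[haar R d]_a mode_quotient x a | <= B.
Proof.
move=> g0 iq.
pose e x a := complex.Re (f1 a * xi a x) / complex.Re (g a).
have opp_even x a : mode_quotient x (opp_tuple a) =
    complex.Re (f1 a * xi a x) / complex.Re (g a) + complex.Im (f2 a * xi a x) / complex.Re (g a).
  rewrite /mode_quotient !realtrig_opp// xi_opp -!(rmorphM conjc) -mulrDl.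
  by case: (f1 a * _) (f2 a * _) (g a) => [? ?] [? ?] [? ?] /=; rewrite opprK.
have eE x : e x = fun a => 2^-1 * (mode_quotient x a + mode_quotient x (opp_tuple a)).
  by apply/funext => a; rewrite opp_even mode_quotientE /e; lra.
have io x := integrable_haarN (iq x).
have ie x : haar_integrable (e x).
  by rewrite eE; apply: haar_integrableZ; apply: haar_integrableD (iq x) (io x).
have inte x : \int[haar R d]_a mode_quotient x a = \int[haar R d]_a e x a.
  have mq := measurable_mode_quotient x.
  rewrite eE RintegralZl//; last exact: (haar_integrableD (iq x) (io x)).
  rewrite RintegralD//; last exact: io.
  by rewrite (Rintegral_haarN mq); field.
(* At [x = 0] the hypothesis says that [Re f1 / Re g] is integrable, and this one function dominates
   the cosine parts for all [x]. *)
have e0 : e 0 = fun a => complex.Re (f1 a) / complex.Re (g a).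
  by apply/funext => a; rewrite /e xi0 mulr1.
have [B B0 hB] : exists2 B, 0 <= B & forall x, haar_integrable (e x) ->
    `| \int[haar R d]_a e x a | <= B.
  apply: (realtrig_quotient_bounded d0 tf1 tg c0 g0 gc).
  by rewrite -e0; exact: ie.
by exists B => // x; rewrite inte; exact: hB.
Qed.

End Quotients.

(** * The Green function: existence, boundedness and the Poisson equation *)

Section Green.
Variables (R : realType) (d k D : nat) (G : periodic_graph d k).
Hypothesis d0 : (0 < d)%N.
Hypothesis k0 : (0 < k)%N.
Hypothesis Greg : regular_graph G D.
Hypothesis Gconn : connected_graph G.
Hypothesis D0 : (0 < D)%N.
Local Notation C := R[i].
Variables (v : d.-tuple R -> 'I_k -> 'cV[C]_k) (lam : d.-tuple R -> 'I_k -> R).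
Hypothesis orthov : forall a, @torus R d a -> forall m n, inner (v a m) (v a n) = (m == n)%:R.
Hypothesis eigv : forall a, @torus R d a -> forall m, Q G D a *m v a m = (lam a m)%:C *: v a m.
Variable u : 'cV[C]_k.
(* [w = 1] for [g^u] and [w a = 1 - xi a (- unit_vec j)] for [g^{u,j}]. *)
Variable w : d.-tuple R -> C.
Hypothesis tw : realtrig w.
Local Notation haar_integrable h := ((haar R d).-integrable setT (EFin \o h)).
Local Notation g := (@detsym R d k D G).

Definition twisted_integrand (p : vertex d k) (a : d.-tuple R) : R :=
  \sum_(m < k) complex.Re
    (coef v u a m * (1 - (lam a m)%:C)^-1 * w a * tensor (v a m) (xi a) p).

Definition twisted_fun (p : vertex d k) : C :=
  (\int[haar R d]_(a in @torus R d) twisted_integrand p a)%:C.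

Definition twisted_exists : Prop := forall p, torus_integrable (twisted_integrand p).

(** Only a real [r] keeps this in [realtrig], so [u] enters as the two real vectors [re] and
    [im]. *)
Let adjcol (r : 'I_k -> R) (l : 'I_k) (a : d.-tuple R) : C :=
  w a * \sum_(j < k) (\adj (symbol D G a)) l j * (r j)%:C.

Let re j := complex.Re (u j 0).
Let im j := complex.Im (u j 0).

Let realtrig_adjcol r l : realtrig (adjcol r l).
Proof.
apply: realtrigM => //; apply: realtrig_sum => j _.
apply: realtrigM; last exact: realtrig_cst.
by apply: realtrig_adj => ? ?; exact: realtrig_symbol.
Qed.

Let quot l x a := mode_quotient g (adjcol re l) (adjcol im l) x a.

Let measurable_quot l x : measurable_fun setT (quot l x).
Proof. by apply: measurable_mode_quotient => //; exact: realtrig_detsym. Qed.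

Lemma twisted_integrandE x l a : @torus R d a -> a <> origin R d ->
  twisted_integrand (x, l) a = quot l x a.
Proof.
move=> ta a0; rewrite /twisted_integrand -cre_sum.
have cramer := resolvent_cramer (orthov ta) (eigv ta) u l
  (fun m => lam_neq1 Greg Gconn D0 orthov eigv m ta a0).
rewrite -/(symbol D G a) -/(detsym D G a) (detsym_real orthov eigv ta) in cramer.
have gpos : 0 < complex.Re (g a).
  have [c c0 gc] := detsym_lower k0 Greg Gconn D0 orthov eigv.
  by apply: lt_le_trans (gc a ta); rewrite mulr_gt0// exprn_gt0// supn_gt0.
set F := \sum_(m < k) _ in cramer.
rewrite (_ : \sum_(m < k) _ = w a * xi a x * F l 0); last first.
  rewrite /F summxE mulr_sumr; apply: eq_bigr => m _.
  by rewrite /tensor /coef mxE/=; ring.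
have uE j : u j 0 = (re j)%:C + 'i%C * (im j)%:C by rewrite -complexE.
have adjE : (\adj (symbol D G a) *m u) l 0 =
    \sum_(j < k) (\adj (symbol D G a)) l j * (re j)%:C +
    'i%C * \sum_(j < k) (\adj (symbol D G a)) l j * (im j)%:C.
  rewrite mxE mulr_sumr -big_split/=; apply: eq_bigr => j _.
  by rewrite {1}uE mulrDr; congr (_ + _); rewrite mulrCA.
apply: (mulfI (lt0r_neq0 gpos)); rewrite -cre_realM mulrCA cramer adjE.
rewrite /quot /mode_quotient mulrCA divff ?gt_eqF// mulr1 /adjcol.
set S1 := \sum_(j < k) _; set S2 := \sum_(j < k) _.
rewrite (_ : w a * xi a x * (S1 + 'i%C * S2) = w a * S1 * xi a x + 'i%C * (w a * S2 * xi a x)); last by ring.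
by rewrite creD; congr (_ + _); rewrite creM/= mul0r add0r mul1r.
Qed.

Lemma twisted_integrableP x l :
  torus_integrable (twisted_integrand (x, l)) <-> haar_integrable (quot l x).
Proof. by apply: torus_integrableP => // a; exact: twisted_integrandE. Qed.

Lemma twisted_funE x l : torus_integrable (twisted_integrand (x, l)) ->
  twisted_fun (x, l) = (\int[haar R d]_a quot l x a)%:C.
Proof.
move=> it; rewrite /twisted_fun; congr (_%:C).
by apply: torus_integralE => // a; exact: twisted_integrandE.
Qed.

Lemma twisted_existsW : (d = 1%N -> real_vec u) ->
  (3 <= d)%N \/ w (origin R d) = 0 \/ \sum_(l < k) u l 0 = 0 -> twisted_exists.
Proof.
move=> d1 h [x l]; apply/twisted_integrableP.
have [c c0 gc] := detsym_lower k0 Greg Gconn D0 orthov eigv.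
apply: (integrable_mode_quotient d0 (realtrig_detsym R Greg) c0 gc) => //.
  case: h => [|[w0|u0]]; first by left.
    by right; rewrite /adjcol w0 mul0r.
  right; rewrite /adjcol.
  have r0 : \sum_(j < k) (\col_j (re j)%:C : 'cV[C]_k) j 0 = 0.
    under eq_bigr do rewrite mxE.
    by rewrite -rmorph_sum/= -cre_sum u0.
  have := adj_symbol_origin k0 Greg Gconn D0 l r0; rewrite mxE => h0.
  rewrite (_ : \sum_(j < k) _ = 0) ?mulr0// -[RHS]h0.
  by apply: eq_bigr => j _; rewrite [X in _ = _ * X]mxE.
(* For [d >= 2] a pole of order 1 is integrable. For [d = 1] it is not, but it comes from the
   imaginary part of [u], which is 0 there. *)
have [d2|d2] := leqP 2 d; [by left|right].
apply/funext => a; rewrite /adjcol big1 ?mulr0// => j _.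
by rewrite /im d1 ?mulr0//; apply/eqP; rewrite eqn_leq d0 -ltnS d2.
Qed.

Lemma twisted_bounded : twisted_exists -> bounded_vfun twisted_fun.
Proof.
move=> te; have [c c0 gc] := detsym_lower k0 Greg Gconn D0 orthov eigv.
have hB l : exists B : R, 0 <= B /\ forall x, `| \int[haar R d]_a quot l x a | <= B.
  have [||B B0 hB] := mode_quotient_bounded d0 (realtrig_detsym R Greg) c0 gc
    (realtrig_adjcol re l) (realtrig_adjcol im l).
  - by rewrite (detsym_origin R k0 Greg D0).
  - by move=> x; apply/twisted_integrableP.
  - by exists B.
have [B hB'] := choice hB.
exists (\sum_(l < k) B l) => -[x l]; rewrite twisted_funE//.
rewrite normc_def/= expr0n addr0 sqrtr_sqr lecR.
apply: le_trans ((hB' l).2 x) _; rewrite (bigD1 l)//= lerDl.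
by apply: sumr_ge0 => l' _; exact: (hB' l').1.
Qed.

Lemma Rintegral_sum I (s : seq I) (h : I -> d.-tuple R -> R) :
  (forall i, haar_integrable (h i)) ->
  haar_integrable (fun a => \sum_(i <- s) h i a) /\
  \int[haar R d]_a (\sum_(i <- s) h i a) = \sum_(i <- s) \int[haar R d]_a h i a.
Proof.
move=> ih; elim: s => [|i s [IH1 IH2]].
  have -> : (fun a : d.-tuple R => \sum_(i <- [::]) h i a) = fun=> 0.
    by apply/funext => a; rewrite big_nil.
  by rewrite big_nil Rintegral_haar_cst; split=> //; exact: integrable_haar_cst.
have -> : (fun a => \sum_(j <- i :: s) h j a) = fun a => h i a + \sum_(j <- s) h j a.
  by apply/funext => a; rewrite big_cons.
by split; [exact: haar_integrableD|rewrite RintegralD// IH2 big_cons].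
Qed.

(** Each vertex has finitely many neighbours, so [A] passes under the integral by linearity alone;
    the identity is then checked pointwise off the origin, where the determinant can be
    cancelled. *)
Lemma twisted_green x l : real_vec u -> twisted_exists ->
  I_minus_A G D twisted_fun (x, l) =
  (\int[haar R d]_a complex.Re (w a * xi a x))%:C * u l 0.
Proof.
move=> ru te; have [X [uniqX oppX suppX]] := finite_range Greg.
have iq l' x' : haar_integrable (quot l' x') by apply/twisted_integrableP.
have im0 j : im j = 0 by rewrite /im ru.
have uE : u l 0 = (re l)%:C by apply: complex_eqP => //=; rewrite ru.
rewrite /I_minus_A (walk_opE D uniqX suppX).
under eq_bigr => y _ do under eq_bigr => j _ do rewrite twisted_funE//.
rewrite twisted_funE// uE.
pose S a := \sum_(y <- X) \sum_(j < k) (G (0, l) (y, j))%:R * quot j (x + y) a.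
have iGq y j : haar_integrable (fun a => (G (0, l) (y, j))%:R * quot j (x + y) a).
  exact: haar_integrableZ.
have iGs y := Rintegral_sum (index_enum 'I_k) (iGq y).
have [iS intS] : haar_integrable S /\ \int[haar R d]_a S a =
    \sum_(y <- X) \sum_(j < k) (G (0, l) (y, j))%:R * \int[haar R d]_a quot j (x + y) a.
  have [h1 h2] := Rintegral_sum X (fun y => (iGs y).1).
  split=> //; rewrite /S h2; apply: eq_bigr => y _; rewrite (iGs y).2.
  by apply: eq_bigr => j _; rewrite RintegralZl.
have -> : \sum_(y <- X) \sum_(j < k) (G (0, l) (y, j))%:R *
    (\int[haar R d]_a quot j (x + y) a)%:C = (\int[haar R d]_a S a)%:C :> C.
  rewrite intS rmorph_sum/=; apply: eq_bigr => y _.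
  rewrite rmorph_sum/=; apply: eq_bigr => j _.
  by rewrite rmorphM/= rmorph_nat.
rewrite -(rmorph_nat (real_complex R)) -fmorphV -rmorphM -rmorphB -rmorphM/=; congr (_%:C).
rewrite -RintegralZl// -RintegralB//; last exact: haar_integrableZ.
have twx : realtrig (fun a => w a * xi a x) by apply: realtrigM => //; exact: realtrig_xi.
rewrite mulrC -RintegralZl//; last first.
  have [B B0 hB] := realtrig_bounded twx.
  apply: (@haar_bounded_integrable _ _ B); first exact: measurable_Re_realtrig.
  by move=> a; exact: (hB a).1.
apply: ae_Rintegral => //.
- apply: measurable_funB => //; apply: measurable_funM => //.
  by have /measurable_int/measurable_EFinP := iS.
- by apply: measurable_funM => //; exact: measurable_Re_realtrig.
move=> a ta a0.
have gpos : 0 < complex.Re (g a).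
  have [c c0 gc] := detsym_lower k0 Greg Gconn D0 orthov eigv.
  by apply: lt_le_trans (gc a ta); rewrite mulr_gt0// exprn_gt0// supn_gt0.
pose U j := \sum_(i < k) (\adj (symbol D G a)) j i * (re i)%:C.
have quotE j y : quot j y a = complex.Re (w a * xi a y * U j) / complex.Re (g a).
  have im_sum : \sum_(i < k) (\adj (symbol D G a)) j i * (im i)%:C = 0.
    by rewrite big1// => i _; rewrite im0 mulr0.
  by rewrite /quot /mode_quotient /adjcol im_sum mulr0 mul0r subr0 mulrAC.
apply: (mulIf (lt0r_neq0 gpos)); rewrite mulrBl.
(* Since [xi a (x + y) = xi a x * xi a y], averaging over the neighbours of [(x, l)] amounts to
   applying row [l] of [Q] to the profile [U]. *)
have SE : D%:R^-1 * S a * complex.Re (g a) = complex.Re (w a * xi a x *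
    (\sum_(j < k) Q G D a l j * U j)).
  have -> : \sum_(j < k) Q G D a l j * U j =
     (D%:R^-1)%:C * \sum_(y <- X) \sum_(j < k) ((G (0, l) (y, j))%:R)%:C * (xi a y * U j).
    rewrite exchange_big mulr_sumr; apply: eq_bigr => j _.
    rewrite (QE D uniqX suppX) fmorphV rmorph_nat -mulrA mulr_suml; congr (_ * _).
    by apply: eq_bigr => y _; rewrite rmorph_nat; ring.
  rewrite mulrCA cre_realM -mulrA; congr (_ * _).
  rewrite /S mulr_suml mulr_sumr [RHS]cre_sum; apply: eq_bigr => y _.
  rewrite mulr_suml mulr_sumr [RHS]cre_sum; apply: eq_bigr => j _.
  rewrite [X in _ = complex.Re X]mulrCA cre_realM -mulrA; congr (_ * _).
  by rewrite quotE divfK ?gt_eqF// xiD !mulrA.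
rewrite SE quotE divfK ?gt_eqF//.
rewrite -creN -creD -mulrN -mulrDr.
have -> : U l + - (\sum_(j < k) Q G D a l j * U j) = (complex.Re (g a))%:C * (re l)%:C.
  pose r : 'cV[C]_k := \col_j (re j)%:C.
  have UE j : U j = (\adj (symbol D G a) *m r) j 0.
    by rewrite [RHS]mxE; apply: eq_bigr => i _; rewrite [X in _ = _ * X]mxE.
  have /matrixP/(_ l 0) : symbol D G a *m (\adj (symbol D G a) *m r) = g a *: r.
    by rewrite mulmxA mul_mx_adj mul_scalar_mx.
  rewrite {1}/symbol mulmxBl mul1mx mxE [X in _ + X]mxE [X in _ - X]mxE.
  rewrite (detsym_real orthov eigv ta) [RHS]mxE [X in _ * X]mxE -UE => <-.
  by congr (_ - _); apply: eq_bigr => j _; rewrite UE.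
rewrite (_ : w a * xi a x * _ = (complex.Re (g a) * re l)%:C * (w a * xi a x)); last first.
  by rewrite rmorphM/= mulrC.
by rewrite cre_realM; ring.
Qed.

End Green.

(** The self-edge, moved to the cell of 0, counts in the degree. Thus [D%:R^-1] is a genuine inverse
    and not the default value 0. *)
Lemma self_edge_degree_gt0 d k D (G : periodic_graph d k) :
  regular_graph G D -> has_self_edge G -> (0 < D)%N.
Proof.
move=> Greg [[y l] Gp]; have [X [uniqX _ suppX]] := finite_range Greg.
have G0 : (0 < G (0%R, l) (0%R, l))%N by rewrite mult_translate subrr in Gp.
have X0 : 0 \in X by apply: (suppX _ l l); rewrite -lt0n.
rewrite -(out_degree Greg uniqX suppX l) (bigD1_seq (0 : 'rV[int]_d))//= (bigD1 l)//=.
by rewrite !addn_gt0 G0.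
Qed.

Section Shift.
Variables (R : realType) (d : nat) (j : 'I_d).

Lemma expi2pi_shift (a : d.-tuple R) : expi2pi (- tnth a j) = xi a (- unit_vec j).
Proof. by rewrite /xi dotN dot_unit. Qed.

Lemma realtrig_difference :
  realtrig (fun a : d.-tuple R => 1 - expi2pi (- tnth a j)).
Proof.
apply: realtrigD; first exact: realtrig_cst.
apply: realtrigN; have := @realtrig_xi R d (- unit_vec j).
by apply: realtrig_ext => a; rewrite expi2pi_shift.
Qed.

Lemma integral_difference (x : 'rV[int]_d) :
  \int[haar R d]_a complex.Re ((1 - expi2pi (- tnth a j)) * xi a x) =
  (x == 0)%:R - (x == unit_vec j)%:R.
Proof.
under eq_Rintegral do rewrite expi2pi_shift mulrBl mul1r -xiD creD creN.
rewrite RintegralB//; [|exact: integrable_Re_xi|exact: integrable_Re_xi].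
by rewrite !integral_Re_xi [- unit_vec j + x]addrC subr_eq0.
Qed.

End Shift.

Local Close Scope complex_scope.
Local Close Scope classical_set_scope.

Theorem theorem2p2 (R : realType) (d k D : nat) (hd : (1 <= d)%N) (hk : (1 <= k)%N)
    (G : periodic_graph d k)
    (Gconn : connected_graph G) (Greg : regular_graph G D) (Gself : has_self_edge G)
    (v : d.-tuple R -> 'I_k -> 'cV[R[i]]_k) (lam : d.-tuple R -> 'I_k -> R)
    (hv : measurable_eigenbasis G D v lam)
    (u : 'cV[R[i]]_k) :
  (* (i) *)
  ((d = 1%N -> real_vec u) ->
     (forall j : 'I_d, gj_exists v lam u j) /\
     ((3 <= d)%N \/ ((d = 1%N \/ d = 2%N) /\ \sum_(l < k) u l 0 = 0) ->
        g_exists v lam u))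
  /\
  (* (ii) *)
  (real_vec u ->
     (g_exists v lam u ->
        I_minus_A G D (g_fun v lam u) = tensor u (delta R 0)) /\
     (forall j : 'I_d, gj_exists v lam u j ->
        I_minus_A G D (gj_fun v lam u j)
        = tensor u (fun x => delta R 0 x - delta R (unit_vec j) x)))
  /\
  (* (iii) *)
  ((g_exists v lam u -> bounded_vfun (g_fun v lam u)) /\
   (forall j : 'I_d, gj_exists v lam u j -> bounded_vfun (gj_fun v lam u j))).
Proof.
have D0 := self_edge_degree_gt0 Greg Gself.
case: hv => _ orthov eigv.
have gE p : g_integrand v lam u p = twisted_integrand v lam u (fun=> 1) p.
  by apply/funext => a; apply: eq_bigr => m _; rewrite mulr1.
have gxE : g_exists v lam u = twisted_exists v lam u (fun=> 1).
  by rewrite /g_exists /twisted_exists; under eq_forall do rewrite gE.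
have gfE : g_fun v lam u = twisted_fun v lam u (fun=> 1).
  by apply/funext => p; rewrite /g_fun /twisted_fun gE.
have t1 : realtrig (fun _ : d.-tuple R => 1) by exact: realtrig_cst.
have tj := @realtrig_difference R d.
rewrite gxE gfE; split; [|split; [|split]].
- move=> ru; split.
    move=> j; apply: (twisted_existsW hd hk Greg Gconn D0 orthov eigv (tj j)) => //.
    right; left; rewrite expi2pi_shift xi_origin subrr//.
  move=> h; apply: (twisted_existsW hd hk Greg Gconn D0 orthov eigv t1) => //.
  by case: h => [d3|[_ u0]]; [left|right; right].
- move=> ru; split.
    move=> ge; apply/funext => -[x l].
    rewrite (twisted_green hd hk Greg Gconn D0 orthov eigv t1)//.
    under eq_Rintegral do rewrite mul1r.
    by rewrite integral_Re_xi rmorph_nat.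
  move=> j ge; apply/funext => -[x l].
  rewrite [LHS](twisted_green hd hk Greg Gconn D0 orthov eigv (tj j))//.
  by rewrite integral_difference rmorphB/= !rmorph_nat.
- exact: (twisted_bounded hd hk Greg Gconn D0 orthov eigv t1).
- by move=> j; exact: (twisted_bounded hd hk Greg Gconn D0 orthov eigv (tj j)).
Qed.
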